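(* Let $d$ be a positive integer and $\nu\in\mathbb{Q}$. The natural map $$\Psi:\ \mathrm{Max}^d_{S_\nu}\longrightarrow \mathrm{Free}^d_{S_{\nu,\pi}}\times \mathrm{Free}^d_{S_{\nu,u}},\qquad \mathcal{M}\mapsto(\mathcal{M}_\pi,\mathcal{M}_u)$$ is injective, and its image consists of the pairs $(A,B)$ such that $A$ and $B$ generate the same $\mathcal{E}$-vector space in $\mathcal{E}^d$. If a pair $(A,B)$ satisfies this condition, its unique preimage under $\Psi$ is given by $A\cap B$. Furthermore, for all $\mathcal{M},\mathcal{M}'\in\mathrm{Max}^d_{S_\nu}$, $$\Psi(\mathcal{M}\cap\mathcal{M}')=(\mathcal{M}_\pi\cap\mathcal{M}'_\pi,\ \mathcal{M}_u\cap\mathcal{M}'_u),\qquad \Psi(\mathcal{M}+_{\max}\mathcal{M}')=(\mathcal{M}_\pi+\mathcal{M}'_\pi,\ \mathcal{M}_u+\mathcal{M}'_u).$$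
   Context: $R$ is a complete discrete valuation ring with uniformizer $\pi$ and fraction field $K$; $v_K$ is the valuation on $K$ normalized by $v_K(\pi)=1$. Write $\nu=\beta/\alpha$ with $\alpha\ge 1$ and $\alpha,\beta$ coprime integers. Define: - $S_\nu=\{\sum_{i\ge 0}a_iu^i\in K[[u]] : v_K(a_i)+\nu i\ge 0\ \forall i\}$; - $S_{\nu,\pi}=S_\nu[1/\pi]=\{\sum_{i\ge0}a_iu^i : a_i\in K,\ v_K(a_i)+\nu i \text{ bounded below}\}$; - $S_{\nu,u}$, the completion of $S_\nu[\pi^\beta/u^\alpha]$ for the Gauss valuation $v_\nu(\sum a_iu^i)=\min_i(v_K(a_i)+\nu i)$, i.e. $S_{\nu,u}=\{\sum_{i\in\mathbb{Z}}a_iu^i: a_i\in K,\ v_K(a_i)+\nu i\ge0,\ \lim_{i\to-\infty}(v_K(a_i)+\nu i)=+\infty\}$; - $\mathcal{E}=\{\sum_{i\in\mathbb{Z}}a_iu^i: a_i\in K,\ v_K(a_i)+\nu i\text{ bounded below},\ \lim_{i\to-\infty}(v_K(a_i)+\nu i)=+\infty\}$, a field containing all the rings above. A morphism of finitely generated $S_\nu$-modules is a quasi-isomorphism if its kernel and cokernel have finite length. A finitely generated torsion-free $S_\nu$-module $\mathcal{M}'$ together with a quasi-isomorphism $f:\mathcal{M}\to\mathcal{M}'$ from a finitely generated torsion-free module $\mathcal{M}$ is maximal for $\mathcal{M}$ if for every finitely generated torsion-free $\mathcal{N}$ and every quasi-isomorphism $f':\mathcal{M}\to\mathcal{N}$ there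 is $g:\mathcal{N}\to\mathcal{M}'$ with $g\circ f'=f$; it is then unique up to isomorphism and denoted $\mathrm{Max}(\mathcal{M})$. For a submodule $\mathcal{M}\subset S_\nu^d$ it is realized as $\mathrm{Max}(\mathcal{M})=\{x\in S_\nu^d:\exists n\in\mathbb{N},\ \pi^nx\in\mathcal{M}\text{ and }(u^\alpha/\pi^\beta)^nx\in\mathcal{M}\}$; $\mathcal{M}$ is called maximal if $\mathrm{Max}(\mathcal{M})=\mathcal{M}$. $\mathrm{Max}^d_{S_\nu}$ is the set of maximal sub-$S_\nu$-modules of $S_\nu^d$, and $\mathcal{M}+_{\max}\mathcal{M}'=\mathrm{Max}(\mathcal{M}+\mathcal{M}')$. For $A=S_{\nu,\pi}$ or $S_{\nu,u}$, $\mathrm{Free}^d_A$ is the set of sub-$A$-modules of $A^d$ that are free over $A$. For an $S_\nu$-submodule $\mathcal{M}$ of $\mathcal{E}^d$, $\mathcal{M}_\pi$ (resp. $\mathcal{M}_u$) is the sub-$S_{\nu,\pi}$-module (resp. sub-$S_{\nu,u}$-module) of $\mathcal{E}^d$ generated by $\mathcal{M}$. *)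

(* Defs.v *)
From HB Require Import structures.
From mathcomp Require Import all_boot all_order all_algebra.
From mathcomp Require Import fraction.
From mathcomp Require Import boolp classical_sets functions.
From mathcomp Require Import zify ring lra.

Set Implicit Arguments.
Unset Strict Implicit.
Unset Printing Implicit Defensive.

Import Order.TTheory GRing.Theory Num.Theory.
Local Open Scope classical_set_scope.
Local Open Scope ring_scope.

(* [vge_of v x q] is "v x >= q" with the convention v 0 = +oo; the value of
   [v] at 0 is never used. *)
Definition vge_of (K : fieldType) (v : K -> int) (x : K) (q : rat) : Prop :=
  x != 0 -> q <= (v x)%:~R.

(* A discrete valuation ring is the valuation ring of a normalized discrete
   valuation on its fraction field. *)
HB.mixin Record isCompleteDVR R of GRing.IntegralDomain R := {
  vK : {fraction R} -> int;
  vKM : forall x y, x != 0 -> y != 0 -> vK (x * y) = vK x + vK y;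
  vKD : forall x y, x != 0 -> y != 0 -> x + y != 0 ->
    Num.min (vK x) (vK y) <= vK (x + y);
  vK_surj : exists x, x != 0 /\ vK x = 1;
  vK_int : forall x, (exists r : R, x = tofrac r) <-> (x != 0 -> 0 <= vK x);
  vK_complete : forall s : nat -> R,
    (forall N : rat, exists m, forall i j, (m <= i)%N -> (m <= j)%N ->
       vge_of vK (tofrac (s i - s j)) N) ->
    exists l : R, forall N : rat, exists m, forall i, (m <= i)%N ->
       vge_of vK (tofrac (s i - l)) N
}.

#[short(type="completeDVRType")]
HB.structure Definition CompleteDVR :=
  { R of isCompleteDVR R & GRing.IntegralDomain R }.

Notation vge := (vge_of vK).

Definition uniformizer (R : completeDVRType) (p : R) : Prop :=
  p != 0 /\ vK (tofrac p) = 1.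

Section Valuation.
Variable R : completeDVRType.
Local Notation K := {fraction R}.
Implicit Types (x y : K) (p q : rat).

Lemma vge0 q : vge (0 : K) q.
Proof. by move/eqP. Qed.

Lemma vge_le x p q : q <= p -> vge x p -> vge x q.
Proof. by move=> qp xp /xp; apply: le_trans. Qed.

Lemma vgeD x y q : vge x q -> vge y q -> vge (x + y) q.
Proof.
have [->|x0] := eqVneq x 0; first by rewrite add0r.
have [->|y0] := eqVneq y 0; first by rewrite addr0.
move=> /(_ x0) xq /(_ y0) yq xy0.
have := vKD _ _ x0 y0 xy0; rewrite -(ler_int rat) => /(le_trans _); apply.
by rewrite /Num.min; case: ifP.
Qed.

Lemma vgeM x y p q : vge x p -> vge y q -> vge (x * y) (p + q).
Proof.
move=> xp yq; rewrite /vge_of mulf_eq0 negb_or => /andP[x0 y0].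
by rewrite vKM // rmorphD /= lerD ?xp ?yq.
Qed.

Lemma vK1 : vK (1 : K) = 0.
Proof.
have := vKM _ _ (oner_neq0 K) (oner_neq0 K); rewrite mulr1 => /esym/eqP.
by rewrite -subr_eq0 addrK => /eqP.
Qed.

Lemma vKN1 : vK (-1 : K) = 0.
Proof.
have N10 : (-1 : K) != 0 by rewrite oppr_eq0 oner_neq0.
have := vKM _ _ N10 N10; rewrite mulrNN mulr1 vK1.
by move/esym/eqP; rewrite -mulr2n mulrn_eq0 /= => /eqP.
Qed.

Lemma vgeN x q : vge x q -> vge (- x) q.
Proof.
move=> xq; rewrite -mulN1r -[q]add0r; apply: vgeM => //.
by move=> _; rewrite vKN1.
Qed.

Lemma vgeB x y q : vge x q -> vge y q -> vge (x - y) q.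
Proof. by move=> xq yq; apply/vgeD/vgeN. Qed.

Lemma vge_sum (I : Type) (s : seq I) (P : pred I) (f : I -> K) q :
  (forall i, P i -> vge (f i) q) -> vge (\sum_(i <- s | P i) f i) q.
Proof.
move=> fq; elim/big_rec: _ => [|i x Pi xq]; first exact: vge0.
by apply: vgeD => //; apply: fq.
Qed.

Lemma vge_eq0 x : (forall N : rat, vge x N) -> x = 0.
Proof.
move=> xN; apply/eqP; apply: contrapT => /negP x0.
have := xN (vK x + 1)%:~R x0; rewrite ler_int; lia.
Qed.

Lemma vK_completeK (s : nat -> K) :
    (forall N, exists m, forall i j, (m <= i)%N -> (m <= j)%N ->
       vge (s i - s j) N) ->
  exists l, forall N, exists m, forall i, (m <= i)%N -> vge (s i - l) N.
Proof.
move=> sC; have [m0 sm0] := sC 0.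
have /choice[r rE] : forall i, exists r : R, s (m0 + i)%N - s m0 = tofrac r.
  move=> i; apply/vK_int => x0; rewrite -(ler_int rat).
  by apply: (sm0 _ _ _ _ x0); rewrite ?leq_addr.
have [N|l lP] := vK_complete r.
  have [m sm] := sC N; exists m => i j mi mj; rewrite rmorphB /= -!rE.
  have -> : s (m0 + i)%N - s m0 - (s (m0 + j)%N - s m0) =
            s (m0 + i)%N - s (m0 + j)%N by ring.
  by apply: sm; apply: (leq_trans _ (leq_addl _ _)).
exists (s m0 + tofrac l) => N; have [m lm] := lP N.
exists (m0 + m)%N => i mi.
have := lm (i - m0)%N; rewrite rmorphB /= -rE subnKC; last first.
  by apply: leq_trans mi; apply: leq_addr.
have -> : s i - s m0 - tofrac l = s i - (s m0 + tofrac l) by ring.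
apply; lia.
Qed.

End Valuation.

(* Unconditional summation of families of elements of the complete field K. *)
Definition has_sum (R : completeDVRType) (I : eqType) (f : I -> {fraction R})
    (S : {fraction R}) : Prop :=
  forall N : rat, exists s0 : seq I, forall s : seq I,
    uniq s -> {subset s0 <= s} -> vge (S - \sum_(i <- s) f i) N.

Definition isum (R : completeDVRType) (I : eqType) (f : I -> {fraction R}) :
  {fraction R} := xget 0 [set S | has_sum f S].

Section Summation.
Variable R : completeDVRType.
Local Notation K := {fraction R}.

Definition summable (I : eqType) (f : I -> K) : Prop :=
  forall N : rat, exists s0 : seq I, forall i, i \notin s0 -> vge (f i) N.

Lemma sum_sub_vge (I : eqType) (f : I -> K) (F s : seq I) (N : rat) :
  uniq F -> uniq s -> {subset F <= s} ->
  (forall i, i \notin F -> vge (f i) N) ->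
  vge (\sum_(i <- s) f i - \sum_(i <- F) f i) N.
Proof.
move=> uF us Fs fN; rewrite (bigID (mem F)) /=.
have -> : \sum_(i <- s | i \in F) f i = \sum_(i <- F) f i.
  rewrite -big_filter; apply: perm_big; apply: uniq_perm => //.
    exact: filter_uniq.
  move=> i; rewrite mem_filter; case: (boolP (i \in F)) => //= /Fs ->.
  by [].
rewrite addrAC subrr add0r; exact: vge_sum.
Qed.

Lemma has_sum_approx (I : eqType) (f : I -> K) S (F : seq I) (N : rat) :
  has_sum f S -> uniq F -> (forall i, i \notin F -> vge (f i) N) ->
  vge (S - \sum_(i <- F) f i) N.
Proof.
move=> fS uF fN; have [s0 s0P] := fS N.
have -> : S - \sum_(i <- F) f i = S - \sum_(i <- undup (F ++ s0)) f i +
    (\sum_(i <- undup (F ++ s0)) f i - \sum_(i <- F) f i) by ring.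
apply: vgeD.
  apply: s0P; first exact: undup_uniq.
  by move=> i is0; rewrite mem_undup mem_cat is0 orbT.
apply: sum_sub_vge => //; first exact: undup_uniq.
by move=> i iF; rewrite mem_undup mem_cat iF.
Qed.

Lemma has_sum_bound (I : eqType) (f : I -> K) S (N : rat) :
  has_sum f S -> (forall i, vge (f i) N) -> vge S N.
Proof.
move=> fS fN; rewrite -[S]subr0 -(big_nil 0 +%R xpredT f).
exact: has_sum_approx.
Qed.

Lemma has_sum_unique (I : eqType) (f : I -> K) S S' :
  has_sum f S -> has_sum f S' -> S = S'.
Proof.
move=> fS fS'; apply/eqP; rewrite -subr_eq0; apply/eqP/vge_eq0 => N.
have [s0 s0P] := fS N; have [s1 s1P] := fS' N.
set s := undup (s0 ++ s1); have us : uniq s by exact: undup_uniq.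
have -> : S - S' = (S - \sum_(i <- s) f i) - (S' - \sum_(i <- s) f i) by ring.
by apply: vgeB; [apply: s0P|apply: s1P] => // i ii;
  rewrite mem_undup mem_cat ii ?orbT.
Qed.

Lemma isumE (I : eqType) (f : I -> K) S : has_sum f S -> isum f = S.
Proof.
move=> fS; apply: (has_sum_unique _ fS).
by rewrite /isum; have /= := @xgetI {fraction R} 0 (has_sum f) S fS.
Qed.

Lemma summable_has_sum (I : eqType) (f : I -> K) :
  summable f -> has_sum f (isum f).
Proof.
move=> sf; suff [S fS] : exists S, has_sum f S by rewrite (isumE fS).
have /choice[t tP] : forall n : nat, exists s0 : seq I,
    forall i, i \notin s0 -> vge (f i) n%:R by move=> n; exact: sf.
pose T := fix T n := if n is n'.+1 then undup (t n ++ T n') else undup (t 0%N).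
have uT n : uniq (T n) by case: n => [|n]; exact: undup_uniq.
have TS n : {subset T n <= T n.+1}.
  by move=> i iT; rewrite /= mem_undup mem_cat iT orbT.
have Tle m n : (m <= n)%N -> {subset T m <= T n}.
  elim: n => [|n IH]; first by rewrite leqn0 => /eqP->.
  rewrite leq_eqVlt ltnS => /orP[/eqP->//|/IH mn] i /mn; exact: TS.
have fT n i : i \notin T n -> vge (f i) n%:R.
  move=> iT; apply: tP; apply: contra iT.
  by case: n => [|n]; rewrite /= mem_undup // mem_cat => ->.
have nat_ge (N : rat) : exists m : nat, N <= m%:R.
  exists (Num.bound `|N|); apply: ltW.
  by apply: le_lt_trans (ler_norm _) _; apply: archi_boundP.
have sC m i : (m <= i)%N ->
    vge (\sum_(k <- T i) f k - \sum_(k <- T m) f k) m%:R.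
  by move=> mi; apply: sum_sub_vge => //; [apply: Tle|apply: fT].
have [N|S SP] := @vK_completeK R (fun n => \sum_(k <- T n) f k).
  have [m Nm] := nat_ge N; exists m => i j mi mj.
  apply: (vge_le Nm).
  have -> : \sum_(k <- T i) f k - \sum_(k <- T j) f k =
    (\sum_(k <- T i) f k - \sum_(k <- T m) f k) -
    (\sum_(k <- T j) f k - \sum_(k <- T m) f k) by ring.
  by apply: vgeB; apply: sC.
exists S => N; have [m Nm] := nat_ge N; have [m' Sm'] := SP N.
pose M := maxn m m'; exists (T M) => s us Ts.
have -> : S - \sum_(i <- s) f i = - (\sum_(i <- T M) f i - S) -
  (\sum_(i <- s) f i - \sum_(i <- T M) f i) by ring.
apply: vgeB; first by apply/vgeN/Sm'; rewrite leq_maxr.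
apply: sum_sub_vge => // i /fT; apply: vge_le; apply: le_trans Nm _.
by rewrite ler_nat leq_maxl.
Qed.

Lemma has_sumD (I : eqType) (f g : I -> K) S T :
  has_sum f S -> has_sum g T -> has_sum (fun i => f i + g i) (S + T).
Proof.
move=> fS gT N; have [s0 s0P] := fS N; have [s1 s1P] := gT N.
exists (s0 ++ s1) => s us ss; rewrite big_split /= opprD addrACA.
by apply: vgeD; [apply: s0P|apply: s1P] => // i ii;
  apply: ss; rewrite mem_cat ii ?orbT.
Qed.

Lemma has_sumZ (I : eqType) (f : I -> K) c S :
  has_sum f S -> has_sum (fun i => c * f i) (c * S).
Proof.
move=> fS N; have [s0 s0P] := fS (N - (vK c)%:~R).
exists s0 => s us ss; rewrite -mulr_sumr -mulrBr.
have -> : N = (vK c)%:~R + (N - (vK c)%:~R) by ring.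
by apply: vgeM; [move=> _|apply: s0P].
Qed.

Lemma has_sum_reindex (I J : eqType) (h : I -> J) (h' : J -> I)
    (f : J -> K) S :
  cancel h h' -> cancel h' h -> has_sum f S -> has_sum (f \o h) S.
Proof.
move=> hK h'K fS N; have [s0 s0P] := fS N.
exists (map h' s0) => s us ss.
have := s0P (map h s); rewrite big_map; apply.
  by rewrite map_inj_uniq //; exact: can_inj hK.
move=> j js0; rewrite -[j]h'K; apply: map_f; apply: ss; exact: map_f.
Qed.

Lemma summable_slice (I J : eqType) (f : I * J -> K) i :
  summable f -> summable (fun j => f (i, j)).
Proof.
move=> sf N; have [s0 s0P] := sf N; exists (map snd s0) => j js.
by apply: s0P; apply: contra js => js; apply/mapP; exists (i, j).
Qed.

Lemma has_sum_fubini (I J : eqType) (f : I * J -> K) S :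
  summable f -> has_sum f S -> has_sum (fun i => isum (fun j => f (i, j))) S.
Proof.
move=> sf fS N; have [s0 s0P] := sf N.
exists (map fst s0) => s us ss; set U := undup (map snd s0).
have uU : uniq U by exact: undup_uniq.
have : vge (S - \sum_(x <- [seq (i, j) | i <- s, j <- U]) f x) N.
  apply: has_sum_approx => //.
    by apply: allpairs_uniq => // -[? ?] [].
  case=> i j ij; apply: s0P; apply: contra ij => ij.
  apply/allpairsP; exists (i, j); split=> //=.
    by apply: ss; apply/mapP; exists (i, j).
  by rewrite mem_undup; apply/mapP; exists (i, j).
rewrite big_allpairs => SN.
have -> : S - \sum_(i <- s) isum (fun j => f (i, j)) =
   S - \sum_(i <- s) \sum_(j <- U) f (i, j)
   - \sum_(i <- s) (isum (fun j => f (i, j)) - \sum_(j <- U) f (i, j)).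
  by rewrite sumrB; ring.
apply: vgeB => //; apply: vge_sum => i _; apply: has_sum_approx => //.
  by apply: summable_has_sum; apply: summable_slice.
move=> j jU; apply: s0P; apply: contra jU => ij.
by rewrite mem_undup; apply/mapP; exists (i, j).
Qed.

Lemma has_sum1 (I : eqType) (f : I -> K) a :
  (forall i, i != a -> f i = 0) -> has_sum f (f a).
Proof.
move=> f0 N; exists [:: a] => s us /(_ a (mem_head _ _)) sa.
rewrite (bigD1_seq a) //= big1 ?addr0 ?subrr; first exact: vge0.
by move=> i /f0.
Qed.

End Summation.

(* [gauss_ge nu c a] : v_K(a_i) + nu i >= c for all i;
   [gauss_lim nu a] : v_K(a_i) + nu i tends to +oo as i tends to -oo. *)
Definition gauss_ge (R : completeDVRType) (nu c : rat)
    (a : int -> {fraction R}) : Prop :=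
  forall i, vge (a i) (c - nu * i%:~R).

Definition gauss_lim (R : completeDVRType) (nu : rat)
    (a : int -> {fraction R}) : Prop :=
  forall c : rat, exists m : int, forall i, i <= m ->
    vge (a i) (c - nu * i%:~R).

Definition power_series (R : completeDVRType)
    (a : int -> {fraction R}) : Prop :=
  forall i, i < 0 -> a i = 0.

(* The bi-infinite series sum_(i in Z) a_i u^i, given by their coefficients;
   multiplication is convolution, which converges unconditionally in K. *)
Record calE (R : completeDVRType) (nu : rat) := CalE {
  coef : int -> {fraction R};
  coefP : (exists c, gauss_ge nu c coef) /\ gauss_lim nu coef
}.

Section LaurentRing.
Variables (R : completeDVRType) (nu : rat).
Local Notation K := {fraction R}.
Local Notation E := (calE R nu).
Implicit Types a b : E.

HB.instance Definition _ := gen_eqMixin E.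
HB.instance Definition _ := gen_choiceMixin E.

Lemma calE_eq a b : coef a =1 coef b -> a = b.
Proof.
case: a b => [a aP] [b bP] /= /funext ab; case: b / ab bP => bP.
by rewrite (Prop_irrelevance aP bP).
Qed.

Lemma zeroE_subproof :
  (exists c, gauss_ge nu c (fun _ => 0 : K)) /\ gauss_lim nu (fun _ => 0 : K).
Proof. by split=> [|c]; exists 0 => i *; exact: vge0. Qed.
Definition zeroE := CalE zeroE_subproof.

Lemma oppE_subproof a :
  (exists c, gauss_ge nu c (fun i => - coef a i)) /\
  gauss_lim nu (fun i => - coef a i).
Proof.
case: a => a [[c ac] al] /=; split; first by exists c => i; exact: vgeN.
by move=> d; have [m am] := al d; exists m => i im; apply/vgeN/am.
Qed.
Definition oppE a := CalE (oppE_subproof a).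

Lemma addE_subproof a b :
  (exists c, gauss_ge nu c (fun i => coef a i + coef b i)) /\
  gauss_lim nu (fun i => coef a i + coef b i).
Proof.
case: a b => a [[c ac] al] [b [[d bd] bl]] /=; split.
  exists (Num.min c d) => i.
  by apply: vgeD; [move: (ac i)|move: (bd i)]; apply: vge_le;
    rewrite lerD2r ge_min lexx ?orbT.
move=> N; have [m am] := al N; have [n bn] := bl N.
exists (Num.min m n) => i; rewrite le_min => /andP[im iN].
by apply: vgeD; [apply: am|apply: bn].
Qed.
Definition addE a b := CalE (addE_subproof a b).

Lemma addEA : associative addE.
Proof. by move=> a b c; apply: calE_eq => i /=; rewrite addrA. Qed.
Lemma addEC : commutative addE.
Proof. by move=> a b; apply: calE_eq => i /=; rewrite addrC. Qed.
Lemma add0E : left_id zeroE addE.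
Proof. by move=> a; apply: calE_eq => i /=; rewrite add0r. Qed.
Lemma addNE : left_inverse zeroE oppE addE.
Proof. by move=> a; apply: calE_eq => i /=; rewrite addNr. Qed.

HB.instance Definition _ := GRing.isZmodule.Build E addEA addEC add0E addNE.

Lemma int_range (m n : int) :
  exists s : seq int, forall i, m < i -> i < n -> i \in s.
Proof.
exists [seq m + k%:Z | k <- iota 0 `|n - m|] => i mi iN.
apply/mapP; exists `|i - m|%N; last by lia.
by rewrite mem_iota; lia.
Qed.

Lemma conv_summable a b (n : int) :
  summable (fun i => coef a i * coef b (n - i)).
Proof.
case: a b => a [[c ac] al] [b [[d bd] bl]] /= N.
have [m am] := al (N - d + nu * n%:~R).
have [p bp] := bl (N - c + nu * n%:~R).
have [s sP] := int_range m (n - p); exists s => i iNs.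
have [im|mi] := leP i m.
  apply: vge_le (vgeM (am i im) (bd (n - i))); rewrite rmorphB /=; lra.
have [ip|pi] := leP (n - i) p.
  apply: vge_le (vgeM (ac i) (bp _ ip)); rewrite rmorphB /=; lra.
by case/negP: iNs; apply: sP => //; lia.
Qed.

Definition conv a b (n : int) : K := isum (fun i => coef a i * coef b (n - i)).

Lemma mulE_subproof a b :
  (exists c, gauss_ge nu c (conv a b)) /\ gauss_lim nu (conv a b).
Proof.
have hs n := summable_has_sum (conv_summable a b n).
rewrite /conv; case: a b hs => a [[c ac] al] [b [[d bd] bl]] /= hs; split.
  exists (c + d) => n; apply: has_sum_bound (hs n) _ => i.
  apply: vge_le (vgeM (ac i) (bd (n - i))); rewrite rmorphB /=; lra.
move=> N; have [m am] := al (N - d); have [p bp] := bl (N - c).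
exists (m + p) => n nmp; apply: has_sum_bound (hs n) _ => i.
have [im|mi] := leP i m.
  apply: vge_le (vgeM (am i im) (bd (n - i))); rewrite rmorphB /=; lra.
have ip : n - i <= p by lia.
apply: vge_le (vgeM (ac i) (bp _ ip)); rewrite rmorphB /=; lra.
Qed.

Definition mulE a b := CalE (mulE_subproof a b).

Lemma mulEC : commutative mulE.
Proof.
move=> a b; apply: calE_eq => n /=; apply: isumE.
have hs := summable_has_sum (conv_summable b a n).
have hK : involutive (fun i : int => n - i) by move=> i; ring.
have := has_sum_reindex hK hK hs; congr has_sum.
by apply/funext => i /=; rewrite hK mulrC.
Qed.

Lemma mulEDl : left_distributive mulE addE.
Proof.
move=> a b c; apply: calE_eq => n /=; apply: isumE.
have := has_sumD (summable_has_sum (conv_summable a c n))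
                 (summable_has_sum (conv_summable b c n)).
by congr has_sum; apply/funext => i; rewrite mulrDl.
Qed.

Lemma conv3_summable a b (c : E) (n : int) :
  summable (fun x : int * int =>
    coef a x.1 * (coef b x.2 * coef c (n - x.1 - x.2))).
Proof.
case: a b c => a [[ca ac] al] [b [[cb bc] bl]] [c [[cc cP] cl]] /= N.
have [m am] := al (N - cb - cc + nu * n%:~R).
have [p bp] := bl (N - ca - cc + nu * n%:~R).
have [q cq] := cl (N - ca - cb + nu * n%:~R).
have [s sP] := int_range m (n - p - q).
have [t tP] := int_range p (n - m - q).
exists [seq (i, j) | i <- s, j <- t] => -[i j] /= ijN.
have [im|mi] := leP i m.
  apply: vge_le (vgeM (am i im) (vgeM (bc j) (cP (n - i - j)))).
  rewrite !rmorphB /=; lra.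
have [jp|pj] := leP j p.
  apply: vge_le (vgeM (ac i) (vgeM (bp j jp) (cP (n - i - j)))).
  rewrite !rmorphB /=; lra.
have [kq|qk] := leP (n - i - j) q.
  apply: vge_le (vgeM (ac i) (vgeM (bc j) (cq _ kq))).
  rewrite !rmorphB /=; lra.
case/negP: ijN; apply/allpairsP; exists (i, j); split => //=.
  by apply: sP => //; lia.
by apply: tP => //; lia.
Qed.

Lemma mulEA : associative mulE.
Proof.
move=> a b c; apply: calE_eq => n /=.
pose F (x : int * int) := coef a x.1 * (coef b x.2 * coef c (n - x.1 - x.2)).
have sF : summable F by exact: conv3_summable.
have hF := summable_has_sum sF.
transitivity (isum F).
  apply: isumE; have := has_sum_fubini sF hF; congr has_sum.
  apply/funext => i; rewrite /F /=; apply: isumE; apply: has_sumZ.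
  exact: summable_has_sum (conv_summable b c (n - i)).
pose h (x : int * int) := (x.2, x.1 - x.2).
pose h' (x : int * int) := (x.1 + x.2, x.1).
have hK : cancel h h' by move=> [k i]; rewrite /h /h' /=; congr pair; ring.
have h'K : cancel h' h by move=> [i j]; rewrite /h /h' /=; congr pair; ring.
have sFh : summable (F \o h).
  move=> N; have [s0 s0P] := sF N; exists (map h' s0) => x xs.
  by apply: s0P; apply: contra xs => xs; rewrite -[x]hK map_f.
apply/esym/isumE; have := has_sum_fubini sFh (has_sum_reindex hK h'K hF).
congr has_sum; apply/funext => k; apply: isumE.
rewrite [X in has_sum _ X]mulrC.
have := has_sumZ (coef c (n - k)) (summable_has_sum (conv_summable a b k)).
congr has_sum; apply/funext => i; rewrite /F /=.
have -> : n - i - (k - i) = n - k by ring.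
by ring.
Qed.

Lemma mono_subproof (x : K) (k : int) :
  (exists c, gauss_ge nu c (fun i => if i == k then x else 0)) /\
  gauss_lim nu (fun i => if i == k then x else 0).
Proof.
split.
  exists ((vK x)%:~R + nu * k%:~R) => i; case: eqP => [->|_].
    by rewrite addrK.
  exact: vge0.
move=> c; exists (k - 1) => i ik; case: eqP => [ik'|_]; last exact: vge0.
by exfalso; lia.
Qed.

(* The monomial x u^k. *)
Definition mono (x : K) (k : int) : E := CalE (mono_subproof x k).

Definition oneE := mono 1 0.

Lemma mul1E : left_id oneE mulE.
Proof.
move=> a; apply: calE_eq => n; apply: isumE => /=.
have := @has_sum1 R int (fun i => (if i == 0 then 1 else 0) * coef a (n - i)) 0.
rewrite eqxx mul1r subr0; apply=> i /negPf->; exact: mul0r.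
Qed.

Lemma oneE_neq0 : oneE != 0 :> E.
Proof.
apply/eqP => /(congr1 (fun a => coef a 0)) /= /eqP.
by rewrite (negPf (oner_neq0 _)).
Qed.

HB.instance Definition _ := GRing.Zmodule_isComNzRing.Build E
  mulEA mulEC mul1E mulEDl oneE_neq0.

Definition S_nu : set E :=
  [set a | power_series (coef a) /\ gauss_ge nu 0 (coef a)].

Definition S_nu_pi : set E :=
  [set a | power_series (coef a) /\ exists c, gauss_ge nu c (coef a)].

Definition S_nu_u : set E :=
  [set a | gauss_ge nu 0 (coef a) /\ gauss_lim nu (coef a)].

End LaurentRing.

Arguments mono {R nu} x k.
Arguments S_nu {R nu}.
Arguments S_nu_pi {R nu}.
Arguments S_nu_u {R nu}.

Section Submodules.
Variables (E : comNzRingType) (d : nat).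
Local Notation V := 'rV[E]_d.
Implicit Types (A : set E) (X N : set V).

Definition cube A : set V := [set x | forall j, A (x 0 j)].

Definition is_submodule A N : Prop :=
  [/\ N 0, forall x y, N x -> N y -> N (x + y)
         & forall a x, A a -> N x -> N (a *: x)].

Definition span_over A X : set V := smallest (is_submodule A) X.

Definition addmod N N' : set V := [set x + y | x in N & y in N'].

Definition independent_over A X : Prop :=
  forall n (x : 'I_n -> V) (a : 'I_n -> E),
    injective x -> (forall i, X (x i)) -> (forall i, A (a i)) ->
    \sum_(i < n) a i *: x i = 0 -> forall i, a i = 0.

Definition free_over A N : Prop :=
  exists X : set V, independent_over A X /\ span_over A X = N.

Definition Free A : set (set V) :=
  [set N | [/\ is_submodule A N, N `<=` cube A & free_over A N]].

End Submodules.

Section MaximalModules.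
Variables (R : completeDVRType) (p : R) (nu : rat) (d : nat).
Local Notation E := (calE R nu).
Local Notation V := 'rV[E]_d.
Implicit Types M : set V.

Definition pi_E : E := mono (tofrac p) 0.

(* u^alpha / pi^beta, where nu = beta / alpha in lowest terms, alpha > 0. *)
Definition t_E : E := mono (tofrac p ^ (- numq nu)) (denq nu).

Definition Max M : set V :=
  [set x | cube S_nu x /\ exists n, M (pi_E ^+ n *: x) /\ M (t_E ^+ n *: x)].

Definition maximal_modules : set (set V) :=
  [set M | [/\ is_submodule S_nu M, M `<=` cube S_nu & Max M = M]].

Definition addmax M M' : set V := Max (addmod M M').

End MaximalModules.

Arguments Max {R} p {nu d} M.
Arguments maximal_modules {R} p {nu d}.
Arguments addmax {R} p {nu d} M M'.

Definition Psi (R : completeDVRType) (nu : rat) (d : nat)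
    (M : set 'rV[calE R nu]_d) :=
  (span_over S_nu_pi M, span_over S_nu_u M).

(* Main.v *)
(* The Gauss valuation makes E a complete discretely valued field with valuation
   ring S_nu_u, while S_nu_pi is euclidean for the Weierstrass degree; so all
   submodules of finite free modules over these two rings are free.  The gluing
   rests on two facts.  First, every element of E is, up to an arbitrarily small
   error, in t^-m S_nu_pi for some m (truncate the negative powers of u), and an
   element of S_nu_u is similarly close to some t^-m S_nu.  This yields
   Max N = N_pi & N_u for every S_nu-submodule N of S_nu^d, and
   (A & B)_pi = A, (A & B)_u = B when A and B have the same E-span.  Second,
   E-spans commute with intersections, by elimination of linear forms. *)
Require Import Defs.
From HB Require Import structures.
From mathcomp Require Import all_boot all_order all_algebra.
From mathcomp Require Import fraction.
From mathcomp Require Import boolp classical_sets functions.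
From mathcomp Require Import zify ring lra.

Set Implicit Arguments.
Unset Strict Implicit.
Unset Printing Implicit Defensive.

Import Order.TTheory GRing.Theory Num.Theory.
Local Open Scope classical_set_scope.
Local Open Scope ring_scope.

(** An approximation places a vector in a module only up to a small error, and the difficulty is to
    absorb that error. For this reason bases over [S_nu_pi] are built together with a bound on the
    loss of Gauss valuation in the coordinates; all sufficiently small elements of N_pi then lie in
    N. The Gauss valuation takes values in (1/alpha)Z. It is multiplied by alpha throughout: weights
    are then integers, minima exist, and a strict inequality is a gain of at least 1, which makes
    the iterations converge. *)

Lemma int_min (P : int -> Prop) (b i0 : int) :
  P i0 -> (forall i, P i -> b <= i) -> exists i, P i /\ forall j, P j -> i <= j.
Proof.
move=> Pi0 Pb.
have Hex : exists n : nat, `[< P (b + n%:Z) >].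
  exists `|i0 - b|%N; apply/asboolP.
  by have := Pb _ Pi0 => bi0; have -> : b + `|i0 - b|%N%:Z = i0 by lia.
case: (ex_minnP Hex) => n /asboolP Pn nmin; exists (b + n%:Z); split=> // j Pj.
have bj := Pb _ Pj; have := nmin `|j - b|%N.
have -> : b + `|j - b|%N%:Z = j by lia.
move=> /(_ (asboolT Pj)); lia.
Qed.

(** * The Gauss valuation *)

Section Weight.
Variables (R : completeDVRType) (nu : rat).
Local Notation K := {fraction R}.
Local Notation E := (calE R nu).
Local Notation alpha := (denq nu).
Local Notation beta := (numq nu).
Implicit Types (a b g q x : E) (k l m n i j : int).

(** The bound is on alpha times the Gauss valuation of [x u^i], an integer. As for [vge], the
    coefficient 0 satisfies every bound. *)
Definition wge k i (x : K) : Prop := x != 0 -> k <= alpha * vK x + beta * i.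

Lemma wge_vge k i (x : K) :
  wge k i x <-> vge x (k%:~R / alpha%:~R - nu * i%:~R).
Proof.
have a0 : (0 : rat) < alpha%:~R by rewrite ltr0z.
have -> : k%:~R / alpha%:~R - nu * i%:~R =
    (k%:~R - beta%:~R * i%:~R) / alpha%:~R.
  by rewrite mulrBl [beta%:~R * _ / _]mulrAC divq_num_den.
split=> H x0; move: (H x0).
  rewrite -(ler_int rat) rmorphD !rmorphM /= ler_pdivrMr // => H'; lra.
rewrite ler_pdivrMr // => H'; rewrite -(ler_int rat) rmorphD !rmorphM /=; lra.
Qed.

Lemma wge_mul k l i j (x y : K) :
  wge k i x -> wge l j y -> wge (k + l) (i + j) (x * y).
Proof.
move=> xk yl; rewrite /wge mulf_eq0 negb_or => /andP[x0 y0].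
by rewrite vKM //; move: (xk x0) (yl y0); lia.
Qed.

Lemma wge_has_sum k i (I : eqType) (f : I -> K) S :
  has_sum f S -> (forall t, wge k i (f t)) -> wge k i S.
Proof.
by move=> fS fk; apply/wge_vge/(has_sum_bound fS) => t; apply/wge_vge.
Qed.

Lemma wgeD k i (x y : K) : wge k i x -> wge k i y -> wge k i (x + y).
Proof. by move=> /wge_vge xk /wge_vge yk; apply/wge_vge/vgeD. Qed.

Lemma wgeN k i (x : K) : wge k i x -> wge k i (- x).
Proof. by move=> /wge_vge xk; apply/wge_vge/vgeN. Qed.

Lemma wge0 k i : wge k i 0. Proof. by rewrite /wge eqxx. Qed.

Lemma wge_le k l i (x : K) : k <= l -> wge l i x -> wge k i x.
Proof. by move=> kl xl x0; apply: le_trans (xl x0). Qed.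

Definition gge k a : Prop := forall i, wge k i (coef a i).

Lemma gge_gauss k a : gge k a <-> gauss_ge nu (k%:~R / alpha%:~R) (coef a).
Proof. by split=> H i; apply/wge_vge/H. Qed.

Lemma gge0_gauss a : gge 0 a <-> gauss_ge nu 0 (coef a).
Proof. by rewrite gge_gauss mul0r. Qed.

Lemma rat_upper (c : rat) : exists k, c <= k%:~R / alpha%:~R.
Proof.
have a0 : (0 : rat) < alpha%:~R by rewrite ltr0z.
exists (Num.bound `|c * alpha%:~R|)%:Z; rewrite ler_pdivlMr //.
apply: ltW; apply: le_lt_trans (ler_norm _) _.
exact: archi_boundP.
Qed.

Lemma gge_ex a : exists k, gge k a.
Proof.
have [[c ac] _] := coefP a; have [k ck] := rat_upper (- c).
exists (- k) => i; apply/wge_vge; apply: vge_le (ac i).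
by rewrite rmorphN mulNr /=; lra.
Qed.

Lemma gge_lim a k : exists m, forall i, i <= m -> wge k i (coef a i).
Proof.
have [_ al] := coefP a; have [m am] := al (k%:~R / alpha%:~R).
by exists m => i im; apply/wge_vge/am.
Qed.

Lemma gge_le k l a : k <= l -> gge l a -> gge k a.
Proof. by move=> kl al i; apply: wge_le (al i). Qed.

Lemma ggeD k a b : gge k a -> gge k b -> gge k (a + b).
Proof. by move=> ak bk i; apply: wgeD. Qed.

Lemma ggeN k a : gge k a -> gge k (- a).
Proof. by move=> ak i; apply: wgeN. Qed.

Lemma ggeB k a b : gge k a -> gge k b -> gge k (a - b).
Proof. by move=> ak bk; apply/ggeD/ggeN. Qed.

Lemma gge0 k : gge k 0.
Proof. by move=> i; exact: wge0. Qed.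

Lemma coefM_has_sum a b n :
  has_sum (fun i => coef a i * coef b (n - i)) (coef (a * b) n).
Proof. exact: summable_has_sum (conv_summable a b n). Qed.

Lemma ggeM k l a b : gge k a -> gge l b -> gge (k + l) (a * b).
Proof.
move=> ak bl n; apply: wge_has_sum (coefM_has_sum a b n) _ => i.
by rewrite {1}(_ : n = i + (n - i)); [exact: wge_mul|lia].
Qed.

Lemma gge_inf a : (forall k, gge k a) -> a = 0.
Proof.
move=> ak; apply: calE_eq => i; apply/eqP; apply: contrapT => /negP a0.
have := ak (alpha * vK (coef a i) + beta * i + 1) i a0; lia.
Qed.

(* For power series, the second component [n] is the Weierstrass degree. *)
Definition lead k n a : Prop :=
  [/\ gge k a, coef a n != 0, alpha * vK (coef a n) + beta * n = k
    & forall i, i < n -> wge (k + 1) i (coef a i)].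

(** Weights are integers bounded below, so a least weight [k] occurs. The indices of weight [k] are
    bounded below because weights tend to infinity towards -oo, so a least such index occurs as
    well. *)
Lemma lead_ex a : a != 0 -> exists k n, lead k n a.
Proof.
move=> a0; have [i0 ai0] : exists i, coef a i != 0.
  apply: contrapT => H; case/eqP: a0; apply: calE_eq => i /=.
  by apply/eqP; apply: contrapT => /negP ai; apply: H; exists i.
pose w i := alpha * vK (coef a i) + beta * i.
have [b ab] := gge_ex a.
have [k [[n1 an1 wn1] kmin]] : exists k,
    (exists2 i, coef a i != 0 & w i = k) /\
    forall l, (exists2 i, coef a i != 0 & w i = l) -> k <= l.
  apply: (@int_min _ b (w i0)); first by exists i0.
  by move=> _ [i ai <-]; exact: ab.
have ak : gge k a by move=> i ai; apply: kmin; exists i.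
have [m am] := gge_lim a (k + 1).
have [n [[an wn] nmin]] : exists n, (coef a n != 0 /\ w n = k) /\
    forall j, coef a j != 0 /\ w j = k -> n <= j.
  apply: (@int_min _ m n1) => // i [ai wi].
  by rewrite leNgt; apply/negP => /ltW /am /(_ ai); rewrite -/(w i); lia.
exists k, n; split=> // i iN ai.
have := kmin (w i) (ex_intro2 _ _ i ai erefl).
rewrite le_eqVlt => /orP[/eqP kw|]; last by rewrite /w; lia.
by have := nmin i (conj ai (esym kw)); lia.
Qed.

(** In the convolution at [n + m], every term except the one at [n] gains 1: below [n] the left
    factor does, above [n] the right factor does, since its index falls below [m]. *)
Lemma coefM_lead k n l m a b : lead k n a -> lead l m b ->
  wge (k + l + 1) (n + m) (coef (a * b) (n + m) - coef a n * coef b m).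
Proof.
move=> [ak an kn alt] [bl bm lm blt].
(* Adding a family supported at [n] removes the main term, so that the difference is itself a sum
   with a termwise bound. *)
have := has_sumD (coefM_has_sum a b (n + m))
  (@has_sum1 R int (fun i => if i == n then - (coef a n * coef b m) else 0)
     n _).
rewrite eqxx => hs; apply: wge_has_sum (hs _) _ => [i /negPf -> //|i].
have nmi : n + m = i + (n + m - i) by lia.
case: (ltgtP i n) => [iN|iN|->].
- rewrite addr0 {1}nmi (_ : k + l + 1 = k + 1 + l); last by lia.
  by apply: wge_mul; [exact: alt|exact: bl].
- rewrite addr0 {1}nmi -addrA; apply: wge_mul; first exact: ak.
  by apply: blt; lia.
- by rewrite (_ : n + m - n = m) ?subrr; [exact: wge0|lia].
Qed.

Lemma vK_dominant (y z : K) :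
  y != 0 -> (z != 0 -> vK y < vK z) -> z + y != 0 /\ vK (z + y) = vK y.
Proof.
move=> y0; have [->|z0 /(_ isT) yz] := eqVneq z 0; first by rewrite add0r.
have vN : vK (- z) = vK z.
  by rewrite -mulN1r vKM ?oppr_eq0 ?oner_neq0 // vKN1 add0r.
have zy0 : z + y != 0.
  by rewrite addr_eq0; apply: contraTneq yz => zE; rewrite -vN zE opprK ltxx.
split=> //; have h1 := vKD _ _ z0 y0 zy0.
have Nz0 : - z != 0 by rewrite oppr_eq0.
have yE : z + y - z = y by rewrite addrAC subrr add0r.
have := vKD _ _ zy0 Nz0; rewrite yE vN => /(_ y0) h2; move: h1 h2 yz.
by move: (vK z) (vK y) (vK (z + y)) => vz vy vzy; lia.
Qed.

(** Multiplicativity of the Gauss valuation: the product of the leading coefficients has weight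
    exactly [k + l] and the remainder weighs at least 1 more, so nothing cancels. *)
Lemma lead_mul k n l m a b : lead k n a -> lead l m b ->
  coef (a * b) (n + m) != 0 /\
  alpha * vK (coef (a * b) (n + m)) + beta * (n + m) = k + l.
Proof.
move=> La Lb; have := coefM_lead La Lb; case: La Lb => _ an kn _ [_ bm lm _].
have y0 := mulf_neq0 an bm; have vy := vKM _ _ an bm.
move: (coef (a * b) _) (coef a n * _) y0 vy => x y y0 vy xy.
have vykl : alpha * vK y + beta * (n + m) = k + l by rewrite vy -kn -lm; ring.
have [|] := @vK_dominant y (x - y) y0; last by rewrite subrK => -> ->.
move=> /xy; rewrite -vykl; have : 0 < alpha by [].
move: (vK y) (vK (x - y)) => vy' vz; nia.
Qed.

Lemma mulE_neq0 a b : a != 0 -> b != 0 -> a * b != 0.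
Proof.
move=> /lead_ex[k [n La]] /lead_ex[l [m Lb]].
have [ab _] := lead_mul La Lb; apply: contra ab => /eqP ->; exact/eqP.
Qed.

Lemma gge_div k n l q g : lead k n g -> gge l (q * g) -> gge (l - k) q.
Proof.
move=> Lg qg; have [->|q0] := eqVneq q 0; first exact: gge0.
have [k' [m Lq]] := lead_ex q0; have [qg0 E1] := lead_mul Lq Lg.
have := qg _ qg0; rewrite E1 => lk; case: Lq => qk _ _ _.
apply: gge_le qk; lia.
Qed.

End Weight.

(** * Division in E and in bounded power series *)

Section Division.
Variables (R : completeDVRType) (nu : rat).
Local Notation K := {fraction R}.
Local Notation E := (calE R nu).
Local Notation alpha := (denq nu).
Local Notation beta := (numq nu).
Implicit Types (a b g h q x y z : E) (k l m n i j : int).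

Definition ord_ge n a : Prop := forall i, i < n -> coef a i = 0.

Lemma ord_geD n a b : ord_ge n a -> ord_ge n b -> ord_ge n (a + b).
Proof. by move=> an bn i iN; rewrite /= an // bn // addr0. Qed.

Lemma ord_geN n a : ord_ge n a -> ord_ge n (- a).
Proof. by move=> an i iN; rewrite /= an // oppr0. Qed.

Lemma ord_geB n a b : ord_ge n a -> ord_ge n b -> ord_ge n (a - b).
Proof. by move=> an bn; apply/ord_geD/ord_geN. Qed.

Lemma ord_ge_le n m a : m <= n -> ord_ge n a -> ord_ge m a.
Proof. by move=> mn an i im; apply: an; apply: lt_le_trans mn. Qed.

Lemma ord_geM n m a b : ord_ge n a -> ord_ge m b -> ord_ge (n + m) (a * b).
Proof.
move=> an bm i inm; apply: (has_sum_unique (coefM_has_sum a b i)).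
have f0 j : coef a j * coef b (i - j) = 0.
  have [jn|nj] := ltP j n; first by rewrite an // mul0r.
  by rewrite bm ?mulr0 //; lia.
by rewrite -(f0 0); apply: has_sum1 => j _; exact: f0.
Qed.

Lemma ord_ge_inf a : (forall n : nat, ord_ge n%:Z a) -> a = 0.
Proof.
move=> an; apply: calE_eq => i; apply: (an (`|i|%N.+1)); lia.
Qed.

Lemma coef_monoM (c : K) j a i :
  coef (mono c j * a) i = c * coef a (i - j).
Proof.
apply: (has_sum_unique (coefM_has_sum _ a i)).
have := @has_sum1 R int (fun t => coef (mono c j : E) t * coef a (i - t)) j.
rewrite /= eqxx; apply=> t /negPf ->; exact: mul0r.
Qed.

Lemma monoM (c d : K) i j : mono c i * mono d j = mono (c * d) (i + j) :> E.
Proof.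
apply: calE_eq => t; rewrite coef_monoM /= [i + j]addrC.
by rewrite subr_eq; case: eqP => // _; rewrite mulr0.
Qed.

Lemma mono1 : mono 1 0 = 1 :> E. Proof. by []. Qed.

Lemma gge_mono k (c : K) j : wge nu k j c -> gge k (mono c j : E).
Proof. by move=> cj i /=; case: eqP => [->//|_]; exact: wge0. Qed.

Lemma gge1 : gge 0 (1 : E).
Proof. by apply: gge_mono => _; rewrite vK1 !mulr0. Qed.

Lemma ord_ge1 : ord_ge 0 (1 : E).
Proof. by move=> i i0 /=; case: eqP => // ii; move: i0; rewrite ii ltxx. Qed.

Lemma power_series_calE (f : int -> K) :
  (forall i, i < 0 -> f i = 0) -> (forall i, wge nu 0 i (f i)) ->
  exists a, coef a =1 f.
Proof.
move=> f0 fw.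
have fP : (exists c, gauss_ge nu c f) /\ gauss_lim nu f.
  split; first by exists (0%:~R / alpha%:~R) => i; apply/wge_vge/fw.
  by move=> c; exists (-1) => i im; rewrite f0; [exact: vge0|lia].
by exists (CalE fP).
Qed.

Lemma trunc_subproof m a :
  (exists c, gauss_ge nu c (fun i => if m <= i then coef a i else 0)) /\
  gauss_lim nu (fun i => if m <= i then coef a i else 0).
Proof.
case: a => a [[c ac] al] /=; split.
  by exists c => i; case: ifP => _; [exact: ac|exact: vge0].
move=> d; have [n an] := al d; exists n => i iN.
by case: ifP => _; [exact: an|exact: vge0].
Qed.
Definition trunc m a : E := CalE (trunc_subproof m a).

Lemma gge_trunc k m a : gge k a -> gge k (trunc m a).
Proof. by move=> ak i /=; case: ifP => _; [exact: ak|exact: wge0]. Qed.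

Lemma ord_ge_trunc m a : ord_ge m (trunc m a).
Proof. by move=> i im /=; rewrite leNgt im. Qed.

Lemma truncB m a b : trunc m (a - b) = trunc m a - trunc m b.
Proof. by apply: calE_eq => i /=; case: ifP => // _; rewrite subr0. Qed.

(** Each coefficient converges in [K], at a rate uniform in the index. *)
Lemma calE_complete (z : nat -> E) k :
  (forall n : nat, gge (k + n%:Z) (z n.+1 - z n)) ->
  exists y, forall n : nat, gge (k + n%:Z) (y - z n).
Proof.
move=> zk.
have zk' (n s : nat) : gge (k + n%:Z) (z (n + s)%N - z n).
  elim: s => [|s IH]; first by rewrite addn0 subrr; exact: gge0.
  rewrite addnS (_ : _ - z n = (z (n + s).+1 - z (n + s)%N) +
    (z (n + s)%N - z n)); last by ring.
  by apply: ggeD IH; apply: gge_le (zk _); lia.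
have /choice[l lP] : forall i, exists l : K,
    forall n : nat, wge nu (k + n%:Z) i (l - coef (z n) i).
  move=> i; have vz (n s : nat) : vge (coef (z (n + s)%N) i - coef (z n) i)
     ((k + n%:Z)%:~R / alpha%:~R - nu * i%:~R).
    by apply/wge_vge; exact: (zk' n s i).
  have [N|l lP] := @vK_completeK R (fun n : nat => coef (z n) i).
    have [k1 k1P] := rat_upper nu (N + nu * i%:~R).
    have Nn (n : nat) : k1 - k <= n%:Z ->
        N <= (k + n%:Z)%:~R / alpha%:~R - nu * i%:~R.
      move=> k1n; rewrite lerBrDr; apply: le_trans k1P _.
      by rewrite ler_wpM2r ?invr_ge0 ?ler0z ?denq_ge0 // ler_int; lia.
    pose M := `|k1 - k|%N.
    have MN : N <= (k + M%:Z)%:~R / alpha%:~R - nu * i%:~R by apply: Nn; lia.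
    exists M => s t Ms Mt.
    rewrite (_ : _ - _ = (coef (z s) i - coef (z M) i) -
      (coef (z t) i - coef (z M) i)); last by ring.
    by rewrite -(subnKC Ms) -(subnKC Mt); apply: vgeB;
      apply: vge_le MN (vz _ _).
  exists l => n; apply/wge_vge.
  have [m mP] := lP ((k + n%:Z)%:~R / alpha%:~R - nu * i%:~R).
  rewrite (_ : _ - _ = (coef (z (n + m)%N) i - coef (z n) i) -
      (coef (z (n + m)%N) i - l)); last by ring.
  by apply: vgeB => //; apply: mP; rewrite leq_addl.
have lE : (exists c, gauss_ge nu c l) /\ gauss_lim nu l.
  split.
    have [c cP] := gge_ex (z 0%N); exists ((Num.min c k)%:~R / alpha%:~R) => i.
    apply/wge_vge; rewrite -[l i](subrK (coef (z 0%N) i)); apply: wgeD.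
      by apply: wge_le (lP i 0%N); rewrite addr0 ge_min lexx orbT.
    by apply: wge_le (cP i); rewrite ge_min lexx.
  (* The decay towards -oo is inherited from a single [z M], whose distance to the limit has weight
     at least [k1]. *)
  move=> c; have [k1 k1P] := rat_upper nu c; pose M := `|k1 - k|%N.
  have [m mP] := gge_lim (z M) k1; exists m => i im.
  apply: (@vge_le _ _ (k1%:~R / alpha%:~R - nu * i%:~R)); first lra.
  apply/wge_vge; rewrite -[l i](subrK (coef (z M) i)); apply: wgeD.
    by apply: wge_le (lP i M); lia.
  exact: mP.
by exists (CalE lE) => n i; exact: lP.
Qed.

(** The iteration [z -> y - P z] is Cauchy, because [P] gains weight 1 at each turn. *)
Lemma contraction_solve (P : E -> E) y :
  (forall a b, P (a - b) = P a - P b) ->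
  (forall k a, gge k a -> gge (k + 1) (P a)) ->
  exists z, z + P z = y.
Proof.
move=> PB Pk; pose z := fix z (n : nat) := if n is m.+1 then y - P (z m) else 0.
have [k yk] := gge_ex y.
have zk (n : nat) : gge (k + n%:Z) (z n.+1 - z n).
  elim: n => [|n IH] /=.
    have P0 : P 0 = 0 by have := PB 0 0; rewrite !subrr.
    by rewrite P0 !subr0.
  rewrite (_ : _ - _ = - P (z n.+1 - z n)); last first.
    by rewrite [P (_ - z n)]PB /=; ring.
  by apply: ggeN; rewrite (_ : _ + _ = k + n%:Z + 1); [exact: Pk|lia].
have [z' z'P] := calE_complete zk; exists z'.
apply: subr0_eq; apply: gge_inf => l; pose n := `|l - k|%N.
apply: (@gge_le _ _ _ (k + n%:Z)); first lia.
rewrite (_ : _ - y = (z' - z n.+1) + P (z' - z n)); last first.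
  by rewrite [P (_ - z n)]PB /=; ring.
by apply: ggeD; [apply: gge_le (z'P _)|apply: gge_le (Pk _ _ (z'P n))]; lia.
Qed.

(** Geometric series. As [g - 1] may have weight 0, the Gauss valuation gives no convergence; it is
    u-adic, [g - 1] being divisible by [u], and all partial sums keep weight at least 0. *)
Lemma power_series_inv g : ord_ge 0 g -> gge 0 g -> coef g 0 = 1 ->
  exists h, [/\ ord_ge 0 h, gge 0 h & g * h = 1].
Proof.
move=> g0 gg g1.
pose w := fix w (n : nat) : E := if n is m.+1 then 1 - (g - 1) * w m else 0.
have gB : ord_ge 1 (g - 1).
  move=> i i1 /=; have [i0|i0] := ltP i 0.
    by rewrite g0 // sub0r; case: eqP => [ii|]; [lia|rewrite oppr0].
  by have -> : i = 0 by [lia]; rewrite g1 eqxx subrr.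
have wS (n : nat) : ord_ge n%:Z (w n.+1 - w n).
  elim: n => [|n IH] /=; first by rewrite mulr0 !subr0; exact: ord_ge1.
  rewrite (_ : _ - _ = - ((g - 1) * (w n.+1 - w n))); last by rewrite /=; ring.
  by apply: ord_geN; rewrite -add1n PoszD; apply: ord_geM.
have wle (n s : nat) : ord_ge n%:Z (w (n + s)%N - w n).
  elim: s => [|s IH]; first by rewrite addn0 subrr => i.
  rewrite addnS (_ : _ - w n = (w (n + s).+1 - w (n + s)%N) +
    (w (n + s)%N - w n)); last by ring.
  by apply: ord_geD IH; apply: ord_ge_le (wS _); lia.
have wg (n : nat) : gge 0 (w n).
  elim: n => [|n IH] /=; first exact: gge0.
  apply: ggeB; first exact: gge1.
  by rewrite -[0]addr0; apply: ggeM IH; apply: ggeB gg gge1.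
have w0 (n : nat) : ord_ge 0 (w n).
  by have := wle 0%N n; rewrite /= subr0.
(* The coefficient at [i] is stationary from the partial sum [w (i + 1)] on. *)
have [||h hE] := @power_series_calE (fun i => coef (w `|i|.+1) i).
- by move=> i i0; apply: w0.
- by move=> i; apply: wg.
have hw (n : nat) : ord_ge n%:Z (h - w n).
  move=> i iN; rewrite /= hE; have [i0|i0] := ltP i 0.
    by rewrite !w0 // subrr.
  have in1 : (`|i|.+1 <= n)%N by lia.
  have := wle `|i|.+1 (n - `|i|.+1)%N i; rewrite subnKC //= => H.
  apply/eqP; rewrite subr_eq0 eq_sym -subr_eq0; apply/eqP/H; lia.
exists h; split.
- by move=> i i0; rewrite hE w0.
- by move=> i; rewrite hE; apply: wg.
apply: subr0_eq; apply: ord_ge_inf => n.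
rewrite (_ : _ - _ = g * (h - w n) - (w n.+1 - w n)); last by rewrite /=; ring.
by apply: ord_geB (wS n); rewrite -[n%:Z]add0r; apply: ord_geM.
Qed.

(* Up to a monomial, [g] is a unit power series plus a tail of negative powers
   of positive valuation. *)
Lemma lead_decomp k n g : lead k n g ->
  exists h s, [/\ ord_ge 0 h, gge 1 s
    & h * (mono (coef g n)^-1 (- n) * g) = 1 + s].
Proof.
move=> [gk gn kn glt]; set G := _ * g.
have GE i : coef G i = (coef g n)^-1 * coef g (i + n).
  by rewrite /G coef_monoM opprK.
have G1 : coef G 0 = 1 by rewrite GE add0r mulVf.
have vinv : vK (coef g n)^-1 = - vK (coef g n).
  have := @vKM R _ _ (invr_neq0 gn) gn; rewrite mulVf // vK1; lia.
have vG m i : wge nu m (i + n) (coef g (i + n)) -> wge nu (m - k) i (coef G i).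
  move=> H; rewrite GE; have := @wge_mul R nu (- k) m (- n) (i + n)
    (coef g n)^-1 _ _ H; rewrite addrC (_ : - n + (i + n) = i); last by lia.
  by apply=> _; rewrite vinv -kn; lia.
have [|||h [h0 hg hG]] := @power_series_inv (trunc 0 G).
- exact: ord_ge_trunc.
- by apply: gge_trunc => i; rewrite -(subrr k); apply: vG; exact: gk.
- exact: G1.
exists h, (h * (G - trunc 0 G)); split; first exact: h0.
  have r1 : gge 1 (G - trunc 0 G); last by have := ggeM hg r1; rewrite add0r.
  move=> i /=; have [i0|i0] := leP; first by rewrite subrr; exact: wge0.
  rewrite subr0 -[1](addrK k) [1 + k]addrC; apply: vG.
  by apply: glt; lia.
by rewrite -hG mulrBr addrC [h * trunc _ _]mulrC subrK.
Qed.

(** After [lead_decomp] only [1 + s] has to be inverted, and multiplication by [s] is a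
    contraction. *)
Lemma calE_inv g : g != 0 -> exists q, q * g = 1.
Proof.
move=> /lead_ex[k [n Lg]]; have [h [s [h0 s1 hG]]] := lead_decomp Lg.
have [||z zE] := @contraction_solve (fun z => z * s) 1.
- by move=> a b; rewrite mulrBl.
- by move=> l a al; apply: ggeM.
exists (z * h * mono (coef g n)^-1 (- n)).
by rewrite -!mulrA hG mulrDr mulr1.
Qed.

Lemma weierstrass_division k n g x : lead k n g ->
  exists q, ord_ge 0 q /\ forall i, n <= i -> coef (x - q * g) i = 0.
Proof.
move=> Lg; have [h [s [h0 s1 hG]]] := lead_decomp Lg.
pose y := mono 1 (- n) * x.
(* Normalized problem: the part of [y - z (1 + s)] at nonnegative indices must vanish. For a power
   series [z] this reads [z + trunc 0 (z * s) = trunc 0 y]. *)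
have [||z zE] := @contraction_solve (fun z => trunc 0 (z * s)) (trunc 0 y).
- by move=> a b; rewrite mulrBl truncB.
- by move=> l a al; apply/gge_trunc/ggeM.
have z0 : ord_ge 0 z.
  rewrite (_ : z = trunc 0 y - trunc 0 (z * s)); last by rewrite -zE; ring.
  by apply: ord_geB; exact: ord_ge_trunc.
(* This quotient undoes the normalization: [x - q g = u^n (y - z (1 + s))]. *)
exists (mono (coef g n)^-1 0 * (z * h)); split.
  rewrite -[0]addr0; apply: ord_geM.
    by move=> i i0 /=; case: eqP => // ii; move: i0; rewrite ii ltxx.
  by rewrite -[0]addr0; apply: ord_geM.
move=> i iN; case: (Lg) => _ gn _ _.
have -> : x - mono (coef g n)^-1 0 * (z * h) * g =
    mono 1 n * (y - z * (1 + s)).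
  have mono_inv : mono 1 n * mono 1 (- n) = 1 :> E.
    by rewrite monoM mulr1 subrr mono1.
  have mono_split : mono (coef g n)^-1 0 =
      mono 1 n * mono (coef g n)^-1 (- n) :> E by rewrite monoM mul1r subrr.
  rewrite mulrBr /y [mono 1 n * (_ * x)]mulrA mono_inv mul1r -hG mono_split.
  congr (_ - _); move: (mono _ _) (mono _ _) => m1 m2; ring.
rewrite coef_monoM mul1r mulrDr mulr1.
have i0 : 0 <= i - n by lia.
have zEi : coef z (i - n) + coef (z * s) (i - n) = coef y (i - n).
  by have := congr1 (fun a => coef a (i - n)) zE; rewrite /= i0.
by rewrite [LHS](_ : _ =
  coef y (i - n) - (coef z (i - n) + coef (z * s) (i - n))) // zEi subrr.
Qed.

Definition principal (A : set E) : Prop := forall I : set E,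
  I `<=` A -> I 0 -> (forall x y, I x -> I y -> I (x + y)) ->
  (forall a x, A a -> I x -> I (a * x)) ->
  exists g, I g /\ forall x, I x -> exists q, A q /\ x = q * g.

Lemma S_nu_piE a : S_nu_pi a <-> ord_ge 0 a.
Proof. by split=> [[]//|a0]; split=> //; have [] := coefP a. Qed.

Lemma S_nu_uE a : S_nu_u a <-> gge 0 a.
Proof.
split=> [[/gge0_gauss //]|/gge0_gauss a0]; split=> //.
by have [] := coefP a.
Qed.

Lemma S_nuE a : S_nu a <-> ord_ge 0 a /\ gge 0 a.
Proof. by split=> -[? /gge0_gauss]. Qed.

(** The generator has least Weierstrass degree [n] in [I]. A remainder of division by it stays in
    [I] and has no coefficient from index [n] on, so it vanishes. *)
Lemma principal_S_nu_pi : principal S_nu_pi.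
Proof.
move=> I IA I0 ID IM.
have [[g [Ig g0]]|H] := pselect (exists g, I g /\ g != 0); last first.
  exists 0; split=> // x Ix; exists 0; split; first by apply/S_nu_piE.
  by rewrite mul0r; apply/eqP; apply: contrapT => /negP x0; apply: H; exists x.
have [n [[g' [Ig' [k Lg']]] nmin]] : exists n,
    (exists g, I g /\ exists k, lead k n g) /\
    forall j, (exists g, I g /\ exists k, lead k j g) -> n <= j.
  have [k [n Lg]] := lead_ex g0.
  apply: (@int_min _ 0 n); first by exists g; split=> //; exists k.
  move=> i [a [Ia [l [_ ai _ _]]]]; rewrite leNgt; apply: contra ai => i0.
  by have /S_nu_piE -> := IA _ Ia.
exists g'; split=> // x Ix.
have [q [q0 qP]] := weierstrass_division x Lg'.
exists q; split; first by apply/S_nu_piE.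
apply/subr0_eq/eqP; apply: contrapT => /negP xq.
have [l [j Lr]] := lead_ex xq; have [_ rj _ _] := Lr.
have jn : j < n by rewrite ltNge; apply: contra rj => /qP ->.
suff : n <= j by rewrite leNgt jn.
apply: nmin; exists (x - q * g'); split; last by exists l.
apply: ID => //; rewrite -mulNr; apply: IM => //.
by apply/S_nu_piE/ord_geN.
Qed.

(** A nonzero element of [I] of least Gauss valuation is a generator: dividing by it in [E] leaves a
    quotient of valuation at least 0. *)
Lemma principal_S_nu_u : principal S_nu_u.
Proof.
move=> I IA I0 ID IM.
have [[g [Ig g0]]|H] := pselect (exists g, I g /\ g != 0); last first.
  exists 0; split=> // x Ix; exists 0; split; first exact/S_nu_uE/gge0.
  by rewrite mul0r; apply/eqP; apply: contrapT => /negP x0; apply: H; exists x.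
have [k [[g' [Ig' [n Lg']]] kmin]] : exists k,
    (exists g, I g /\ exists n, lead k n g) /\
    forall l, (exists g, I g /\ exists n, lead l n g) -> k <= l.
  have [k [n Lg]] := lead_ex g0.
  apply: (@int_min _ 0 k); first by exists g; split=> //; exists n.
  move=> l [a [Ia [j [_ aj <- _]]]]; have /S_nu_uE := IA _ Ia.
  by apply.
have g'0 : g' != 0.
  by case: Lg' => _ + _ _; apply: contra => /eqP ->.
have [h hg] := calE_inv g'0.
exists g'; split=> // x Ix; exists (x * h).
have xE : x = x * h * g' by rewrite -mulrA hg mulr1.
split=> //; apply/S_nu_uE.
have [->|x0] := eqVneq x 0; first by rewrite mul0r; exact: gge0.
have [l [j Lx]] := lead_ex x0.
have kl : k <= l by apply: kmin; exists x; split=> //; exists j.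
apply: (@gge_le _ _ _ (l - k)); first lia.
by apply: gge_div Lg' _; rewrite -xE; case: Lx.
Qed.

End Division.

(** * Submodules and bases *)

Section SpanOver.
Variables (E : comNzRingType) (d : nat).
Local Notation V := 'rV[E]_d.
Implicit Types (A : set E) (N X : set V).

Definition is_subring A : Prop :=
  [/\ A 1, forall x y, A x -> A y -> A (x - y)
         & forall x y, A x -> A y -> A (x * y)].

Lemma subring0 A : is_subring A -> A 0.
Proof. by case=> A1 AB _; rewrite -(subrr 1); exact: AB. Qed.

Lemma subringN A x : is_subring A -> A x -> A (- x).
Proof.
move=> sA Ax; rewrite -sub0r; case: (sA) => _ + _; apply=> //.
exact: subring0.
Qed.

Lemma subringD A x y : is_subring A -> A x -> A y -> A (x + y).
Proof.
move=> sA Ax Ay; rewrite -[y]opprK; case: (sA) => _ + _; apply=> //.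
exact: subringN.
Qed.

Lemma submod_sum A N (I : Type) (s : seq I) (P : pred I) (f : I -> V) :
  is_submodule A N -> (forall i, N (f i)) -> N (\sum_(i <- s | P i) f i).
Proof.
by case=> N0 ND _ Nf; elim/big_rec: _ => [//|i x _ Nx]; apply: ND.
Qed.

Lemma submodB A N x y : is_subring A -> is_submodule A N -> N x -> N y ->
  N (x - y).
Proof.
move=> sA [_ ND NZ] Nx Ny; apply: ND => //; rewrite -scaleN1r; apply: NZ => //.
by apply: subringN => //; case: sA.
Qed.

Lemma submod_sub A B N : A `<=` B -> is_submodule B N -> is_submodule A N.
Proof. by move=> AB [N0 ND NZ]; split=> // a x /AB; exact: NZ. Qed.

Lemma submodI A N N' : is_submodule A N -> is_submodule A N' ->
  is_submodule A (N `&` N').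
Proof.
move=> [N0 ND NZ] [N0' ND' NZ']; split=> //.
  by move=> x y [? ?] [? ?]; split; [exact: ND|exact: ND'].
by move=> a x Aa [? ?]; split; [exact: NZ|exact: NZ'].
Qed.

Lemma submod_addmod A N N' : is_submodule A N -> is_submodule A N' ->
  is_submodule A (addmod N N').
Proof.
move=> [N0 ND NZ] [N0' ND' NZ']; split.
- by exists 0 => //; exists 0 => //; rewrite addr0.
- move=> _ _ [x Nx [x' Nx' <-]] [y Ny [y' Ny' <-]].
  exists (x + y); first exact: ND.
  by exists (x' + y'); [exact: ND'|rewrite addrACA].
- move=> a _ Aa [x Nx [x' Nx' <-]]; exists (a *: x); first exact: NZ.
  by exists (a *: x'); [exact: NZ'|rewrite scalerDr].
Qed.

Lemma submod_cube A : is_subring A -> is_submodule A (cube A : set V).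
Proof.
move=> sA; split=> [j|x y Ax Ay j|a x Aa Ax j]; rewrite mxE.
- exact: subring0.
- exact: subringD.
- by case: sA => _ _; apply.
Qed.

Lemma span_submod A X : is_submodule A (span_over A X).
Proof.
split=> [N [[]] //|x y Xx Xy N NP|a x Aa Xx N NP]; case: (NP) => -[N0 ND NZ] XN.
  by apply: ND; [exact: Xx|exact: Xy].
by apply: NZ => //; exact: Xx.
Qed.

Lemma span_sub A X : X `<=` span_over A X.
Proof. by move=> x Xx N [_]; apply. Qed.

Lemma span_min A X N : is_submodule A N -> X `<=` N -> span_over A X `<=` N.
Proof. by move=> NP XN x; apply. Qed.

Lemma span_mono A B X Y : A `<=` B -> X `<=` Y ->
  span_over A X `<=` span_over B Y.
Proof.
move=> AB XY; apply: span_min; first exact: submod_sub AB (span_submod B Y).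
exact: subset_trans XY (@span_sub B Y).
Qed.

Lemma span_cube A B N : is_subring B -> A `<=` B -> N `<=` cube A ->
  span_over B N `<=` cube B.
Proof.
move=> sB AB NA; apply: span_min; first exact: submod_cube.
by move=> x /NA xA j; exact/AB/xA.
Qed.

Lemma span_span A B X : A `<=` B -> span_over B (span_over A X) = span_over B X.
Proof.
move=> AB; rewrite eqEsubset; split.
  apply: span_min; first exact: span_submod.
  exact: span_mono.
by apply: span_mono => //; exact: span_sub.
Qed.

Lemma span_addmod A N N' : N 0 -> N' 0 ->
  span_over A (addmod N N') = addmod (span_over A N) (span_over A N').
Proof.
move=> N0 N'0; rewrite eqEsubset; split.
  apply: span_min; first by apply: submod_addmod; exact: span_submod.
  move=> _ [x Nx [y Ny <-]]; exists x; first exact: span_sub.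
  by exists y => //; exact: span_sub.
move=> _ [x Nx [y Ny <-]]; have [_ SD _] := span_submod A (addmod N N').
apply: SD.
  apply: span_mono Nx => // z Nz; exists z => //.
  by exists 0 => //; rewrite addr0.
apply: span_mono Ny => // z Nz; exists 0 => //.
by exists z => //; rewrite add0r.
Qed.

Lemma free_family A N r (f : 'I_r -> V) : is_subring A -> is_submodule A N ->
  (forall t, N (f t)) ->
  (forall c : 'I_r -> E, \sum_t c t *: f t = 0 -> forall t, c t = 0) ->
  (forall x, N x -> exists c : 'I_r -> E,
     (forall t, A (c t)) /\ x = \sum_t c t *: f t) ->
  free_over A N.
Proof.
move=> sA NP Nf find fgen; exists [set x | exists t, x = f t]; split.
  move=> n x a x_inj /choice[s sE] Aa sum0 i.
  have s_inj : injective s.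
    by move=> i1 i2 ss; apply: x_inj; rewrite !sE ss.
  (* The relation among the vectors [x i = f (s i)] is regrouped along the fibres of [s], which have
     at most one element. *)
  have := find (fun t => \sum_(i < n | s i == t) a i).
  rewrite (_ : \sum_t _ = 0); last first.
    rewrite -[RHS]sum0 [RHS](partition_big s xpredT) //=.
    apply: eq_bigr => t _; rewrite scaler_suml; apply: eq_bigr => j /eqP <-.
    by rewrite sE.
  move=> /(_ erefl (s i)); rewrite (big_pred1 i) // => j /=.
  by rewrite (inj_eq s_inj).
rewrite eqEsubset; split.
  by apply: span_min => // _ [t ->].
move=> x /fgen[c [Ac ->]]; apply: submod_sum (span_submod A _) _.
move=> t; have [_ _ SZ] := span_submod A [set x | exists t, x = f t].
by apply: SZ => //; apply: (@span_sub A); exists t.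
Qed.

End SpanOver.

(** * Bases with bounded coordinates over principal rings *)

Section Basis.
Variables (R : completeDVRType) (nu : rat) (d : nat).
Local Notation E := (calE R nu).
Local Notation V := 'rV[E]_d.
Implicit Types (A : set E) (N X : set V) (k l : int).

Definition vgge k (x : V) : Prop := forall j, gge k (x 0 j).

Lemma vgge_le k l x : k <= l -> vgge l x -> vgge k x.
Proof. by move=> kl xl j; apply: gge_le (xl j). Qed.

Lemma vggeD k x y : vgge k x -> vgge k y -> vgge k (x + y).
Proof. by move=> xk yk j; rewrite mxE; exact: ggeD. Qed.

Lemma vggeZ k l a x : gge k a -> vgge l x -> vgge (k + l) (a *: x).
Proof. by move=> ak xl j; rewrite mxE; exact: ggeM. Qed.

Lemma vgge_ex x : exists k, vgge k x.
Proof.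
have /choice[f fP] : forall j, exists k, gge k (x 0 j).
  by move=> j; exact: gge_ex.
have [k kP] : exists k, forall j, k <= f j.
  suff [k kP] : exists k, forall j, j \in enum 'I_d -> k <= f j.
    by exists k => j; apply: kP; rewrite mem_enum.
  elim: (enum 'I_d) => [|j s [k IH]]; first by exists 0.
  exists (Num.min k (f j)) => i; rewrite inE => /orP[/eqP ->|/IH ki].
    by rewrite ge_min lexx orbT.
  by rewrite ge_min ki.
by exists k => j; apply: gge_le (fP j).
Qed.

(** The usual induction for submodules of free modules over a principal ring, on the number [m] of
    coordinates allowed to be nonzero. The constant [C] records how much weight is lost in passing
    from a vector to its coordinates on the basis. *)
Lemma bounded_basis_upto A N (m : nat) : (m <= d)%N ->
  is_subring A -> principal A -> is_submodule A N -> N `<=` cube A ->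
  exists r (f : 'I_r -> V) (C : int),
  [/\ forall t, N (f t), forall t (j : 'I_d), (m <= j)%N -> f t 0 j = 0,
      forall c : 'I_r -> E, \sum_t c t *: f t = 0 -> forall t, c t = 0
    & forall l x, N x -> (forall j : 'I_d, (m <= j)%N -> x 0 j = 0) ->
        vgge l x -> exists c : 'I_r -> E,
        (forall t, A (c t) /\ gge (l - C) (c t)) /\ x = \sum_t c t *: f t].
Proof.
move=> + sA pA NP NA; elim: m => [_|m IH md].
  exists 0%N, (fun=> 0), 0; split=> [[]|[]|c _ []|l x Nx x0 _] //.
  exists (fun=> 0); split; first by case.
  by rewrite big_ord0; apply/rowP => j; rewrite mxE x0.
have [r [f [C [Nf fm find fgen]]]] := IH (ltnW md).
pose jm := Ordinal md.
pose Nm x := N x /\ forall j : 'I_d, (m < j)%N -> x 0 j = 0.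
have [N0 ND NZ] := NP.
(* The last coordinates of the vectors of [Nm] form an ideal. A vector [x0] realizing its generator
   joins the basis, unless that generator is 0. *)
have [||||g [[x0 [[Nx0 x0m] x0g]] gP]] :=
    pA [set e | exists x, Nm x /\ x 0 jm = e].
- by move=> _ [x [[Nx _] <-]]; exact: NA.
- by exists 0; split; [split=> // j _|]; rewrite mxE.
- move=> _ _ [x [[Nx xm] <-]] [y [[Ny ym] <-]]; exists (x + y).
  split; last by rewrite mxE.
  by split=> [|j mj]; [exact: ND|rewrite mxE xm ?ym ?addr0].
- move=> a _ Aa [x [[Nx xm] <-]]; exists (a *: x).
  split; last by rewrite mxE.
  by split=> [|j mj]; [exact: NZ|rewrite mxE xm ?mulr0].
have split_m x : (forall j : 'I_d, (m < j)%N -> x 0 j = 0) -> x 0 jm = 0 ->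
    forall j : 'I_d, (m <= j)%N -> x 0 j = 0.
  move=> xm xjm j; rewrite leq_eqVlt => /orP[/eqP mj|/xm //].
  by rewrite -xjm; congr (x _ _); apply: val_inj.
have [g0|g0] := eqVneq g 0.
  exists r, f, C; split=> // [t j /ltnW|l x Nx xm]; first exact: fm.
  apply: fgen => //; apply: split_m => //.
  have [q [_ ->]] := gP _ (ex_intro _ x (conj (conj Nx xm) erefl)).
  by rewrite g0 mulr0.
have [cg [ng Lg]] := lead_ex g0; have [k0 x0k] := vgge_ex x0.
pose f' t := if unlift ord0 t is Some t' then f t' else x0.
(* The coordinate [q] on [x0] loses [cg], the weight of [g]. The rest [x - q x0] has weight at least
   [min l (l - cg + k0)], and its own coordinates lose a further [C]. *)
exists r.+1, f', (Num.max cg (Num.max C (cg - k0 + C))); split.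
- by move=> t; rewrite /f'; case: unlift => [t'|].
- move=> t j mj; rewrite /f'; case: unlift => [t'|]; last exact: x0m.
  exact/fm/ltnW.
- move=> c; rewrite big_ord_recl /f' unlift_none => sum0.
  have sumE : \sum_(i < r) c (lift ord0 i) *: f' (lift ord0 i) =
      \sum_(i < r) c (lift ord0 i) *: f i.
    by apply: eq_bigr => i _; rewrite /f' liftK.
  rewrite sumE in sum0.
  have c0 : c ord0 = 0.
    have := congr1 (fun v : V => v 0 jm) sum0.
    rewrite mxE summxE big1 => [|i _].
      rewrite addr0 !mxE x0g => cg0; apply/eqP; apply: contrapT => /negP c0.
      by have := mulE_neq0 c0 g0; rewrite cg0 eqxx.
    by rewrite mxE fm ?mulr0.
  rewrite c0 scale0r add0r in sum0.
  by move=> t; case: (unliftP ord0 t) => [t' ->|->//]; exact: find sum0 t'.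
- move=> l x Nx xm xl.
  have [q [Aq xq]] := gP _ (ex_intro _ x (conj (conj Nx xm) erefl)).
  have ql : gge (l - cg) q by apply: gge_div Lg _; rewrite -xq.
  pose y := x - q *: x0; pose l' := Num.min l (l - cg + k0).
  have [||| c [cP yE]] := fgen l' y.
  + by apply: submodB sA NP Nx _; exact: NZ.
  + apply: split_m => [j mj|]; first by rewrite !mxE xm // x0m // mulr0 subr0.
    by rewrite !mxE xq x0g subrr.
  + rewrite /y -scaleNr; apply: vggeD.
      by apply: vgge_le xl; rewrite /l'; lia.
    apply: vgge_le (vggeZ (ggeN ql) x0k); rewrite /l'; lia.
  exists (fun t => if unlift ord0 t is Some t' then c t' else q); split.
    move=> t; case: unlift => [t'|].
      have [Ac lc] := cP t'; split=> //; apply: gge_le lc; rewrite /l'; lia.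
    by split=> //; apply: gge_le ql; lia.
  rewrite big_ord_recl /f' unlift_none -[LHS](subrK (q *: x0)) -/y yE addrC.
  by congr (_ + _); apply: eq_bigr => t _; rewrite liftK.
Qed.

Lemma bounded_basis A N : is_subring A -> principal A ->
  is_submodule A N -> N `<=` cube A ->
  exists r (f : 'I_r -> V) (C : int),
  [/\ forall t, N (f t),
      forall c : 'I_r -> E, \sum_t c t *: f t = 0 -> forall t, c t = 0
    & forall l x, N x -> vgge l x -> exists c : 'I_r -> E,
        (forall t, A (c t) /\ gge (l - C) (c t)) /\ x = \sum_t c t *: f t].
Proof.
move=> sA pA NP NA.
have [r [f [C [Nf _ find fgen]]]] := bounded_basis_upto (leqnn d) sA pA NP NA.
exists r, f, C; split=> // l x Nx xl; apply: fgen => // j.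
by rewrite leqNgt ltn_ord.
Qed.

Lemma submod_Free A N : is_subring A -> principal A ->
  is_submodule A N -> N `<=` cube A -> Free A N.
Proof.
move=> sA pA NP NA; split=> //.
have [r [f [C [Nf find fgen]]]] := bounded_basis sA pA NP NA.
apply: (free_family sA NP Nf find) => x Nx.
have [l xl] := vgge_ex x; have [c [cP xE]] := fgen l x Nx xl.
by exists c; split=> // t; have [] := cP t.
Qed.

End Basis.

(** * Approximation *)

Section Rings.
Variables (R : completeDVRType) (p : R) (nu : rat).
Hypothesis hp : uniformizer p.
Local Notation K := {fraction R}.
Local Notation E := (calE R nu).
Local Notation alpha := (denq nu).
Local Notation beta := (numq nu).
Implicit Types (a e x y : E) (k l m : int).
Local Notation pi := (pi_E p nu).
Local Notation t := (t_E p nu).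

(** The inverses of [pi] and [t]: the first lies in [S_nu_pi], the second in [S_nu_u]. *)
Definition piV : E := mono (tofrac p)^-1 0.
Definition tV : E := mono (tofrac p ^ numq nu) (- denq nu).

Lemma varpi_neq0 : tofrac p != 0 :> K.
Proof. by rewrite tofrac_eq0; case: hp. Qed.

Lemma vK_varpiX (n : int) : vK (tofrac p ^ n) = n.
Proof.
have vX (m : nat) : vK (tofrac p ^+ m) = m%:Z.
  elim: m => [|m IH]; first by rewrite expr0 vK1.
  by rewrite exprS vKM ?expf_neq0 ?varpi_neq0 // IH; case: hp => _ ->; lia.
case: n => n; first by rewrite -exprnP vX.
have vn0 := expf_neq0 n.+1 varpi_neq0; rewrite NegzE -exprnN.
have := vKM _ _ (invr_neq0 vn0) vn0; rewrite mulVf // vK1 vX => /esym/eqP.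
by rewrite addr_eq0 => /eqP.
Qed.

Lemma piVK : piV * pi = 1.
Proof. by rewrite monoM mulVf ?varpi_neq0 // addr0. Qed.

Lemma tVK : tV * t = 1.
Proof. by rewrite monoM -expfzDr ?varpi_neq0 // subrr expr0z addNr. Qed.

Lemma piVXK (n : nat) : piV ^+ n * pi ^+ n = 1.
Proof. by rewrite -exprMn piVK expr1n. Qed.

Lemma tVXK (n : nat) : tV ^+ n * t ^+ n = 1.
Proof. by rewrite -exprMn tVK expr1n. Qed.

Lemma ggeX k a (n : nat) : gge k a -> gge (k * n%:Z) (a ^+ n).
Proof.
move=> ak; elim: n => [|n IH]; first by rewrite mulr0; exact: gge1.
by rewrite exprS intS mulrDr mulr1; exact: ggeM.
Qed.

Lemma ord_geX k a (n : nat) : ord_ge k a -> ord_ge (k * n%:Z) (a ^+ n).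
Proof.
move=> ak; elim: n => [|n IH]; first by rewrite mulr0; exact: ord_ge1.
by rewrite exprS intS mulrDr mulr1; exact: ord_geM.
Qed.

Lemma ord_ge_mono (c : K) k : ord_ge k (mono c k : E).
Proof. by move=> i ik /=; case: eqP => // ii; move: ik; rewrite ii ltxx. Qed.

Lemma gge_pi : gge alpha pi.
Proof. by apply: gge_mono => _; rewrite -[tofrac p]expr1z vK_varpiX; lia. Qed.

Lemma gge_piV : gge (- alpha) piV.
Proof. by apply: gge_mono => _; rewrite -exprN1 vK_varpiX; lia. Qed.

Lemma gge_t : gge 0 t.
Proof. by apply: gge_mono => _; rewrite vK_varpiX; lia. Qed.

Lemma gge_tV : gge 0 tV.
Proof. by apply: gge_mono => _; rewrite vK_varpiX; lia. Qed.

Lemma S_nu_pi_subring : is_subring (@S_nu_pi R nu).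
Proof.
split=> [|x y|x y]; first exact/S_nu_piE/ord_ge1.
  by move=> /S_nu_piE ? /S_nu_piE ?; apply/S_nu_piE/ord_geB.
move=> /S_nu_piE ? /S_nu_piE ?; apply/S_nu_piE; rewrite -[0]addr0.
exact: ord_geM.
Qed.

Lemma S_nu_u_subring : is_subring (@S_nu_u R nu).
Proof.
split=> [|x y|x y]; first exact/S_nu_uE/gge1.
  by move=> /S_nu_uE ? /S_nu_uE ?; apply/S_nu_uE/ggeB.
by move=> /S_nu_uE ? /S_nu_uE ?; apply/S_nu_uE; rewrite -[0]addr0; exact: ggeM.
Qed.

Lemma S_nuI x : S_nu x <-> S_nu_pi x /\ S_nu_u x.
Proof. by rewrite S_nuE S_nu_piE S_nu_uE. Qed.

Lemma S_nu_subring : is_subring (@S_nu R nu).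
Proof.
have [A1 AB AM] := S_nu_pi_subring; have [B1 BB BM] := S_nu_u_subring.
split=> [|x y|x y]; first exact/S_nuI.
  by move=> /S_nuI[? ?] /S_nuI[? ?]; apply/S_nuI; split; [exact: AB|exact: BB].
by move=> /S_nuI[? ?] /S_nuI[? ?]; apply/S_nuI; split; [exact: AM|exact: BM].
Qed.

Lemma setT_subring : is_subring (@setT E).
Proof. by []. Qed.

Lemma S_nu_sub_pi : @S_nu R nu `<=` S_nu_pi.
Proof. by move=> x /S_nuI[]. Qed.

Lemma S_nu_sub_u : @S_nu R nu `<=` S_nu_u.
Proof. by move=> x /S_nuI[]. Qed.

Lemma subringX (A : set E) a (n : nat) : is_subring A -> A a -> A (a ^+ n).
Proof.
move=> [A1 _ AM] Aa; elim: n => [|n IH]; first by rewrite expr0.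
by rewrite exprS; exact: AM.
Qed.

Lemma S_nu_piX (n : nat) : S_nu (pi ^+ n).
Proof.
apply: subringX S_nu_subring _; apply/S_nuE; split; first exact: ord_ge_mono.
by apply: gge_le gge_pi.
Qed.

Lemma S_nu_tX (n : nat) : S_nu (t ^+ n).
Proof.
apply: subringX S_nu_subring _; apply/S_nuE; split; last exact: gge_t.
by apply: ord_ge_le (@ord_ge_mono _ _).
Qed.

Lemma S_nu_pi_piVX (n : nat) : S_nu_pi (piV ^+ n).
Proof.
by apply: subringX S_nu_pi_subring _; apply/S_nu_piE; exact: ord_ge_mono.
Qed.

Lemma S_nu_u_tVX (n : nat) : S_nu_u (tV ^+ n).
Proof. by apply: subringX S_nu_u_subring _; apply/S_nu_uE; exact: gge_tV. Qed.

Lemma calE_bounded e : exists n : nat, S_nu_u (pi ^+ n * e).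
Proof.
have [k ek] := gge_ex e; exists `|k|%N; apply/S_nu_uE.
apply: gge_le (ggeM (ggeX (n := `|k|%N) gge_pi) ek).
have : 0 < alpha by []; nia.
Qed.

Lemma S_nu_pi_bounded e : S_nu_pi e -> exists n : nat, S_nu (pi ^+ n * e).
Proof.
move=> Se; have [n Sn] := calE_bounded e; exists n.
apply/S_nuI; split; last exact: Sn.
have [_ _ AM] := S_nu_pi_subring; apply: AM Se; exact/S_nu_sub_pi/S_nu_piX.
Qed.

(** Drop from [e] the terms below an index [m], all of weight at least [alpha n]. Multiplying by
    [t ^ |m|] raises the order by [alpha |m| >= |m|], which clears the remaining negative powers,
    and costs no weight since [t] has Gauss valuation 0. *)
Lemma calE_approx e (n : nat) : exists (s : nat) e' eps,
  [/\ e = e' + pi ^+ n * eps, S_nu_pi (t ^+ s * e'), S_nu_u eps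
    & S_nu_u e -> S_nu (t ^+ s * e')].
Proof.
have [m em] := gge_lim e (alpha * n%:Z).
pose e' := trunc m e; exists `|m|%N, e', (piV ^+ n * (e - e')).
have Se' : S_nu_pi (t ^+ `|m|%N * e').
  apply/S_nu_piE; apply: ord_ge_le (ord_geM
    (ord_geX (n := `|m|%N) (@ord_ge_mono _ _)) (@ord_ge_trunc _ _ m e)).
  have : 0 < alpha by []; nia.
split=> //.
- by rewrite mulrA [pi ^+ n * _]mulrC piVXK mul1r addrC subrK.
- have eps : gge (alpha * n%:Z) (e - e').
    move=> i /=; case: leP => [_|/ltW /em im]; last by rewrite subr0.
    by rewrite subrr; exact: wge0.
  apply/S_nu_uE; apply: gge_le (ggeM (ggeX (n := n) gge_piV) eps); lia.
- move=> /S_nu_uE e0; apply/S_nuI; split=> //; apply/S_nu_uE.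
  rewrite -[0]addr0; apply: ggeM; last exact: gge_trunc.
  by have /S_nuI[_ /S_nu_uE] := S_nu_tX `|m|%N.
Qed.

End Rings.

(** * The formula for [Max], and recovering two modules from their intersection *)

Section Modules.
Variables (R : completeDVRType) (p : R) (nu : rat) (d : nat).
Hypothesis hp : uniformizer p.
Local Notation E := (calE R nu).
Local Notation V := 'rV[E]_d.
Local Notation pi := (pi_E p nu).
Local Notation t := (t_E p nu).
Local Notation piV := (piV p nu).
Local Notation tV := (tV p nu).
Local Notation span_pi := (span_over (@S_nu_pi R nu)).
Local Notation span_u := (span_over (@S_nu_u R nu)).
Local Notation span_E := (span_over (@setT E)).
Implicit Types (M N A B : set V) (x y z : V).

(** Common form of two localizations at [pi]: from [S_nu] to [S_nu_pi], and from [S_nu_u] to [E]. *)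
Lemma span_localize (S S' : set E) N x :
  is_subring S -> S `<=` S' -> S pi -> S' piV ->
  (forall a, S' a -> exists n, S (pi ^+ n * a)) -> is_subring S' ->
  is_submodule S N -> span_over S' N x <-> exists n, N (pi ^+ n *: x).
Proof.
move=> sS SS' Spi S'piV Sb sS' [N0 ND NZ].
have SpiX n : S (pi ^+ n) by exact: subringX.
split=> [|[n Nx]]; last first.
  have -> : x = piV ^+ n *: (pi ^+ n *: x) by rewrite scalerA piVXK // scale1r.
  have [_ _ SZ] := span_submod S' N; apply: SZ; last exact: span_sub.
  exact: subringX.
move: x; apply: span_min; last first.
  by move=> x Nx; exists 0%N; rewrite expr0 scale1r.
split=> [|x y [n Nx] [m Ny]|a x /Sb[m Sa] [n Nx]].
- by exists 0%N; rewrite scaler0.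
- exists (n + m)%N; rewrite scalerDr exprD {1}mulrC -!scalerA.
  by apply: ND; apply: NZ.
- exists (m + n)%N; rewrite scalerA exprD (_ : _ * a = pi ^+ m * a * pi ^+ n).
    by rewrite -scalerA; exact: NZ.
  by rewrite mulrAC.
Qed.

Lemma span_piP N x : is_submodule S_nu N ->
  span_pi N x <-> exists n, N (pi ^+ n *: x).
Proof.
apply: span_localize.
- exact: S_nu_subring.
- exact: S_nu_sub_pi.
- exact: (S_nu_piX nu hp 1).
- exact: (S_nu_pi_piVX p nu 1).
- exact: S_nu_pi_bounded.
- exact: S_nu_pi_subring.
Qed.

Lemma span_EP N x : is_submodule S_nu_u N ->
  span_E N x <-> exists n, N (pi ^+ n *: x).
Proof.
apply: span_localize.
- exact: S_nu_u_subring.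
- by [].
- exact/S_nu_sub_u/(S_nu_piX nu hp 1).
- by [].
- by move=> a _; exact: calE_bounded.
- exact: setT_subring.
Qed.

Lemma submod_u_unit B (n : nat) x : is_submodule S_nu_u B ->
  B (t ^+ n *: x) -> B x.
Proof.
move=> [_ _ BZ] Bx; rewrite -[x]scale1r -(tVXK nu hp n) -scalerA.
by apply: BZ => //; exact: S_nu_u_tVX.
Qed.

(** Since [S_nu_u] is the completion of [S_nu[1/t]], elements of N_u are limits of elements of
    [N[1/t]]. *)
Lemma span_u_approx N x (k : nat) : is_submodule S_nu N -> N `<=` cube S_nu ->
  span_u N x -> exists (m : nat) y,
    N y /\ vgge (denq nu * k%:Z) (t ^+ m *: x - y).
Proof.
move=> [N0 ND NZ] NS; move: x; apply: span_min; last first.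
  move=> x Nx; exists 0%N, x; split=> // j.
  by rewrite scale1r subrr mxE; exact: gge0.
have tX0 n : gge 0 (t ^+ n) by have /S_nuE[] := S_nu_tX nu hp n.
split.
- exists 0%N, 0; split=> // j; rewrite scaler0 subrr mxE; exact: gge0.
- move=> x x' [m [y [Ny xy]]] [m' [y' [Ny' xy']]].
  exists (m + m')%N, (t ^+ m' *: y + t ^+ m *: y'); split.
    by apply: ND; apply: NZ => //; exact: S_nu_tX.
  rewrite (_ : _ - _ = t ^+ m' *: (t ^+ m *: x - y) +
    t ^+ m *: (t ^+ m' *: x' - y')).
    by apply: vggeD; rewrite -[_ * _]add0r; apply: vggeZ.
  by apply/rowP => j; rewrite !mxE exprD; ring.
- move=> c x Sc [m [y [Ny xy]]].
  have [s [c' [eps [cE _ Seps Sc']]]] := calE_approx hp c k.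
  exists (m + s)%N, ((t ^+ s * c') *: y); split; first exact/NZ/Ny/Sc'.
  (* The error splits into the one on [x], multiplied by [c], and the one on [c], which is
     [pi ^ k eps], multiplied by the integral vector [y]. *)
  rewrite (_ : _ - _ = (t ^+ s * c) *: (t ^+ m *: x - y) +
    (t ^+ s * eps) *: (pi ^+ k *: y)); last first.
    by apply/rowP => j; rewrite !mxE exprD cE; ring.
  have tsM a : S_nu_u a -> gge 0 (t ^+ s * a).
    by move=> /S_nu_uE a0; rewrite -[0]addr0; exact: ggeM.
  apply: vggeD; first by rewrite -[_ * _]add0r; apply: vggeZ => //; exact: tsM.
  rewrite -[_ * _]add0r; apply: vggeZ; first exact: tsM.
  rewrite -[_ * _]addr0; apply: vggeZ; first by apply/ggeX/gge_pi.
  by move=> j; have /S_nuE[] := NS _ Ny j.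
Qed.

(* The coefficients on a basis of the submodule generated over [S_nu_pi] are
   controlled by the Gauss valuation; this replaces the noetherianity of
   [S_nu]. *)
Lemma span_pi_small N : is_submodule S_nu N -> N `<=` cube S_nu ->
  exists k : nat, forall x,
    span_pi N x -> vgge (denq nu * k%:Z) x -> N x.
Proof.
move=> NP NS.
have NpiS := span_cube (S_nu_pi_subring R nu) (@S_nu_sub_pi R nu) NS.
have [r [f [C [Nf _ fgen]]]] := bounded_basis (S_nu_pi_subring R nu)
  (@principal_S_nu_pi R nu) (span_submod _ N) NpiS.
have /choice[n nP] : forall i, exists n : nat, N (pi ^+ n *: f i).
  by move=> i; apply/span_piP.
(* The part [|C|] pays for the loss [C] in the coordinates, the part [n0] for the denominators
   [pi ^ n i] of the basis vectors. *)
pose n0 := (\max_i n i)%N; exists (n0 + `|C|)%N => x Nx xk.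
have [c [cP ->]] := fgen _ x Nx xk; apply: submod_sum (NP) _ => i.
have [/S_nu_piE ci cgge] := cP i; have [_ _ NZ] := NP.
rewrite (_ : _ *: _ = (piV ^+ n i * c i) *: (pi ^+ n i *: f i)); last first.
  by rewrite scalerA mulrAC piVXK // mul1r.
apply: NZ (nP i); apply/S_nuE; split.
  by rewrite -[0]addr0; apply: ord_geM => //; exact/S_nu_piE/S_nu_pi_piVX.
apply: gge_le (ggeM (ggeX (n := n i) (gge_piV hp)) cgge).
have nn0 : (n i <= n0)%N by exact: leq_bigmax.
have : 0 < denq nu by []; move: (denq nu) => al; nia.
Qed.

Lemma MaxE N : is_submodule S_nu N -> N `<=` cube S_nu ->
  Max p N = span_pi N `&` span_u N.
Proof.
move=> NP NS; have [N0 ND NZ] := NP; rewrite eqEsubset; split.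
  move=> x [_ [n [Npi Nt]]]; split; first by apply/span_piP => //; exists n.
  exact: (submod_u_unit (span_submod _ N) (@span_sub _ _ S_nu_u N _ Nt)).
move=> x [xpi xu]; split.
  move=> j; apply/S_nuI; split.
    exact: (span_cube (S_nu_pi_subring R nu) (@S_nu_sub_pi R nu) NS xpi).
  exact: (span_cube (S_nu_u_subring R nu) (@S_nu_sub_u R nu) NS xu).
(* Write [t ^ m x = y + r] with [y] in [N] and [r] small. Since [x] lies in N_pi so does [r], and
   smallness puts [r] in [N]. *)
have [k kP] := span_pi_small NP NS.
have [m [y [Ny xy]]] := span_u_approx k NP NS xu.
have Nt : N (t ^+ m *: x).
  rewrite -[_ *: x](subrK y); apply: ND => //; apply: kP => //.
  apply: submodB (S_nu_pi_subring R nu) (span_submod _ _) _ (span_sub Ny).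
  have [_ _ SZ] := span_submod S_nu_pi N; apply: SZ => //.
  exact/S_nu_sub_pi/S_nu_tX.
have [n Npi] := (span_piP x NP).1 xpi.
(* [Max] asks for the same exponent on [pi] and on [t]. *)
exists (n + m)%N; split.
  by rewrite addnC exprD -scalerA; apply: NZ => //; exact: S_nu_piX.
by rewrite exprD -scalerA; apply: NZ => //; exact: S_nu_tX.
Qed.

Lemma capmod_submod A B : is_submodule S_nu_pi A -> is_submodule S_nu_u B ->
  is_submodule S_nu (A `&` B).
Proof.
move=> AP BP; apply: submodI; first exact: submod_sub (@S_nu_sub_pi R nu) AP.
exact: submod_sub (@S_nu_sub_u R nu) BP.
Qed.

Section SameSpan.
Variables A B : set V.
Hypotheses (AP : is_submodule S_nu_pi A) (BP : is_submodule S_nu_u B).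
Hypothesis AB : span_E A = span_E B.

Lemma same_span_pow x : A x -> exists n, (A `&` B) (pi ^+ n *: x).
Proof.
move=> Ax; have : span_E B x by rewrite -AB; exact: span_sub.
move=> /(span_EP _ BP)[n Bx]; exists n; split=> //.
by have [_ _ AZ] := AP; apply: AZ => //; exact/S_nu_sub_pi/S_nu_piX.
Qed.

Lemma span_pi_cap : span_pi (A `&` B) = A.
Proof.
have NP := capmod_submod AP BP.
rewrite eqEsubset; split; first by apply: span_min AP _ => x [].
by move=> x /same_span_pow/span_piP; apply.
Qed.

(** Density of [A[1/t]] in the E-span, with the error measured in [span_u (A & B)]. The precision
    [k] stays quantified during the induction on the span, because the scalar step calls its
    hypothesis at a higher precision. *)
Lemma span_E_approx x (k : nat) : span_E A x -> exists (m : nat) y z,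
  [/\ A y, span_u (A `&` B) z & t ^+ m *: x = y + pi ^+ k *: z].
Proof.
move=> Ax; move: x Ax k.
have [C0 CD CZ] := span_submod S_nu_u (A `&` B).
have [A0 AD AZ] := AP; have [_ _ uM] := S_nu_u_subring R nu.
have tA n := S_nu_sub_pi (S_nu_tX nu hp n).
have tU n := S_nu_sub_u (S_nu_tX nu hp n).
apply: span_min; last first.
  by move=> x Ax k; exists 0%N, x, 0; split=> //; rewrite scale1r scaler0 addr0.
split.
- by move=> k; exists 0%N, 0, 0; split=> //; rewrite !scaler0 addr0.
- move=> x x' xP x'P k; have [m [y [z [Ay Cz xE]]]] := xP k.
  have [m' [y' [z' [Ay' Cz' x'E]]]] := x'P k.
  exists (m + m')%N, (t ^+ m' *: y + t ^+ m *: y'),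
    (t ^+ m' *: z + t ^+ m *: z'); split.
  + by apply: AD; exact: AZ.
  + by apply: CD; exact: CZ.
  rewrite (_ : _ *: _ = t ^+ m' *: (t ^+ m *: x) + t ^+ m *: (t ^+ m' *: x')).
    by rewrite xE x'E; apply/rowP => j; rewrite !mxE; ring.
  by apply/rowP => j; rewrite !mxE exprD; ring.
(* Precision is bought in advance: [k + s] for [x], where [pi ^ s e] is integral, and [k + n] for
   [e], where [pi ^ n y] lies in [A & B]. *)
- move=> e x _ xP k; have [s es] := calE_bounded hp e.
  have [m [y [z [Ay Cz xE]]]] := xP (k + s)%N.
  have [n ABy] := same_span_pow Ay.
  have [s' [e' [eps [eE Se' Seps _]]]] := calE_approx hp e (k + n).
  exists (m + s')%N, ((t ^+ s' * e') *: y),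
    ((t ^+ s' * eps) *: (pi ^+ n *: y) + (t ^+ s' * (pi ^+ s * e)) *: z); split.
  + exact: AZ.
  + apply: CD; apply: CZ.
    * exact: uM (tU _) Seps.
    * exact: span_sub ABy.
    * exact: uM (tU _) es.
    * exact: Cz.
  rewrite (_ : _ *: _ = (t ^+ s' * e) *: (t ^+ m *: x)); last first.
    by apply/rowP => j; rewrite !mxE exprD; ring.
  rewrite xE {1}eE; apply/rowP => j; rewrite !mxE !exprD.
  have := eE; move: (e) => e0 ->; rewrite exprD; ring.
Qed.

(** Precision 0 suffices: [y = t ^ m x - z] lies in [B] as well as in [A], so [t ^ m x] is in
    [span_u (A & B)], and [t] is a unit of [S_nu_u]. *)
Lemma span_u_cap : span_u (A `&` B) = B.
Proof.
rewrite eqEsubset; split; first by apply: span_min BP _ => x [].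
move=> x Bx; have : span_E A x by rewrite AB; exact: span_sub.
move=> /(span_E_approx 0)[m [y [z [Ay Cz]]]]; rewrite scale1r => xE.
have CB : span_u (A `&` B) `<=` B by apply: span_min BP _ => ? [].
suff : span_u (A `&` B) (t ^+ m *: x).
  by exact: (submod_u_unit (span_submod _ _)).
have [_ CD _] := span_submod S_nu_u (A `&` B).
rewrite xE; apply: CD (Cz); apply: (@span_sub _ _ S_nu_u).
split; first exact: Ay.
rewrite -[y](addrK z) -xE; apply: submodB (S_nu_u_subring R nu) BP _ (CB _ Cz).
by have [_ _ BZ] := BP; apply: BZ => //; exact/S_nu_sub_u/S_nu_tX.
Qed.

Lemma cap_maximal : A `<=` cube S_nu_pi -> B `<=` cube S_nu_u ->
  maximal_modules p (A `&` B).
Proof.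
move=> AS BS; have NP := capmod_submod AP BP.
have NS : A `&` B `<=` cube S_nu.
  by move=> x [Ax Bx] j; apply/S_nuI; split; [exact: AS|exact: BS].
by split=> //; rewrite MaxE // span_pi_cap span_u_cap.
Qed.

End SameSpan.

End Modules.

(** * Spans of intersections *)

Section SpanIntersection.
Variables (R : completeDVRType) (nu : rat).
Local Notation E := (calE R nu).
Local Notation span_E := (span_over (@setT E)).

(** Elimination with a pivot [g] where [lam] is nonzero: each [y] is projected to the kernel of
    [lam] along [g], and this projection fixes [x]. *)
Lemma span_kernel1 (n : nat) (S : set E) (G : set 'rV[E]_n)
    (lam : 'rV[E]_n -> E) x :
  is_subring S -> is_submodule S G ->
  (forall a y z, lam (a *: y + z) = a * lam y + lam z) ->
  (forall y, G y -> S (lam y)) ->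
  span_E G x -> lam x = 0 -> span_E (G `&` [set y | lam y = 0]) x.
Proof.
move=> sS GP lamP lamS.
have lam0 : lam 0 = 0.
  have := lamP 1 0 0; rewrite scaler0 addr0 mul1r => /eqP.
  by rewrite -subr_eq0 opprD addNKr oppr_eq0 => /eqP.
have [[g [Gg g0]]|H] := pselect (exists g, G g /\ lam g != 0); last first.
  rewrite (_ : G `&` _ = G) //; rewrite eqEsubset; split=> [y []//|y Gy].
  by split=> //=; apply/eqP; apply: contrapT => /negP y0; apply: H; exists y.
have [q qg] := calE_inv g0; set W := span_E (_ `&` _).
have [W0 WD WZ] : is_submodule setT W by exact: span_submod.
suff H : span_E G `<=` [set y | W (y - (lam y * q) *: g)].
  by move=> /H /= + x0; rewrite x0 mul0r scale0r subr0.
have lamD y z : lam (y + z) = lam y + lam z.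
  by have := lamP 1 y z; rewrite scale1r mul1r.
have lamZ a y : lam (a *: y) = a * lam y.
  by have := lamP a y 0; rewrite !addr0 lam0 addr0.
apply: span_min.
  split=> /= [|y z Wy Wz|a y _ Wy]; first by rewrite lam0 mul0r scale0r subr0.
    rewrite lamD (_ : _ - _ = y - (lam y * q) *: g + (z - (lam z * q) *: g)).
      exact: WD.
    by apply/rowP => j; rewrite !mxE; ring.
  rewrite lamZ (_ : _ - _ = a *: (y - (lam y * q) *: g)); first exact: WZ.
  by apply/rowP => j; rewrite !mxE; ring.
(* With denominators cleared, [lam g * y - lam y * g] is a combination over [S], hence an element of
   [G] killed by [lam]; only the factor [q] leaves [S]. *)
move=> y Gy /=; rewrite (_ : _ - _ = q *: (lam g *: y - lam y *: g)).
  apply: WZ => //; apply: span_sub; split.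
    have [_ _ GZ] := GP; apply: submodB sS GP _ _; apply: GZ => //.
      exact: lamS.
    exact: lamS.
  by rewrite /= -scaleNr addrC lamP lamZ; ring.
by rewrite scalerBr !scalerA qg scale1r [q * lam y]mulrC.
Qed.

Lemma span_kernel (I : eqType) (n : nat) (S : set E) (G : set 'rV[E]_n)
    (lam : I -> 'rV[E]_n -> E) (s : seq I) x :
  is_subring S -> is_submodule S G ->
  (forall i a y z, lam i (a *: y + z) = a * lam i y + lam i z) ->
  (forall i y, G y -> S (lam i y)) ->
  span_E G x -> (forall i, lam i x = 0) ->
  span_E (G `&` [set y | forall i, i \in s -> lam i y = 0]) x.
Proof.
move=> sS GP lamP lamS Gx x0.
have lam0 i : lam i 0 = 0.
  have := lamP i 1 0 0; rewrite scaler0 addr0 mul1r => /eqP.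
  by rewrite -subr_eq0 opprD addNKr oppr_eq0 => /eqP.
elim: s => [|i s IH]; first by apply: span_mono Gx => // y Gy; split.
have [G0 GD GZ] := GP; set H := G `&` _ in IH.
have HP : is_submodule S H.
  split=> [|y z [Gy y0] [Gz z0]|a y Sa [Gy y0]]; split.
  - exact: G0.
  - by move=> j _; exact: lam0.
  - exact: GD.
  - by move=> j js; rewrite -[y]scale1r lamP y0 // z0 // mulr0 addr0.
  - exact: GZ.
  - by move=> j js; rewrite -[_ *: _]addr0 lamP y0 // lam0 mulr0 addr0.
have := @span_kernel1 n S H (lam i) x sS HP (lamP i).
have HS y : H y -> S (lam i y) by move=> [Gy _]; exact: lamS.
move=> /(_ HS IH (x0 i)); apply: span_mono => // y [[Gy y0] yi]; split=> //.
by move=> j; rewrite inE => /orP[/eqP -> //|]; exact: y0.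
Qed.

(** [A & A'] is the diagonal part of the direct sum [G] of [A] and [A'], cut out by the [d] forms
    [lam j]; they take values in [S] because both modules lie in [cube S]. For [x] in both spans,
    [(x, x)] lies in the span of [G] and in all their kernels. *)
Lemma span_E_cap (d : nat) (S : set E) (A A' : set 'rV[E]_d) :
  is_subring S -> is_submodule S A -> is_submodule S A' ->
  A `<=` cube S -> A' `<=` cube S ->
  span_E (A `&` A') = span_E A `&` span_E A'.
Proof.
move=> sS AP AP' AS AS'; rewrite eqEsubset; split.
  by move=> x Ax; split; apply: span_mono Ax => // y [].
move=> x [Ax Ax'].
pose G := [set y : 'rV[E]_(d + d) | A (lsubmx y) /\ A' (rsubmx y)].
pose lam (j : 'I_d) (y : 'rV[E]_(d + d)) := lsubmx y 0 j - rsubmx y 0 j.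
have [A0 AD AZ] := AP; have [A0' AD' AZ'] := AP'.
have GP : is_submodule S G.
  split=> [|y z [Ay Ay'] [Az Az']|a y Sa [Ay Ay']]; rewrite /G /= ?linear0 //.
    by rewrite !linearD; split; [exact: AD|exact: AD'].
  by rewrite !linearZ; split; [exact: AZ|exact: AZ'].
have Gx : span_E G (row_mx x x).
  have [W0 WD WZ] := span_submod setT G.
  have -> : row_mx x x = row_mx x 0 + row_mx 0 x.
    by rewrite add_row_mx addr0 add0r.
  have spanL : span_E A `<=` [set y | span_E G (row_mx y 0)].
    apply: span_min; last first.
      by move=> y Ay; apply: span_sub; rewrite /G /= row_mxKl row_mxKr.
    split=> /= [|y z Wy Wz|a y _ Wy]; first by rewrite row_mx0.
      by rewrite -[0]addr0 -add_row_mx; exact: WD.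
    by rewrite -[0](scaler0 _ a) -scale_row_mx; exact: WZ.
  have spanR : span_E A' `<=` [set y | span_E G (row_mx 0 y)].
    apply: span_min; last first.
      by move=> y Ay; apply: span_sub; rewrite /G /= row_mxKl row_mxKr.
    split=> /= [|y z Wy Wz|a y _ Wy]; first by rewrite row_mx0.
      by rewrite -[0]addr0 -add_row_mx; exact: WD.
    by rewrite -[0](scaler0 _ a) -scale_row_mx; exact: WZ.
  by apply: WD; [exact: spanL|exact: spanR].
have lamP j a y z : lam j (a *: y + z) = a * lam j y + lam j z.
  by rewrite /lam !mxE; ring.
have lamS j y : G y -> S (lam j y).
  move=> [Ay Ay']; have [_ SB _] := sS.
  by apply: SB; [exact: AS|exact: AS'].
have lamx j : lam j (row_mx x x) = 0 by rewrite /lam row_mxKl row_mxKr subrr.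
have := span_kernel (s := enum 'I_d) sS GP lamP lamS Gx lamx.
set D := G `&` _ => H.
suff : span_E D `<=` [set y | span_E (A `&` A') (lsubmx y)].
  by move=> /(_ _ H) /=; rewrite row_mxKl.
apply: span_min.
  have [W0 WD WZ] := span_submod setT (A `&` A').
  split=> /= [|y z Wy Wz|a y _ Wy]; first by rewrite linear0.
    by rewrite linearD; exact: WD.
  by rewrite linearZ; exact: WZ.
move=> y [[Ay Ay'] y0]; apply: span_sub; split=> //.
rewrite (_ : lsubmx y = rsubmx y) //; apply/rowP => j; apply: subr0_eq.
by apply: y0; rewrite mem_enum.
Qed.

End SpanIntersection.

(** * Gluing *)

Section Gluing.
Variables (R : completeDVRType) (p : R) (nu : rat) (d : nat).
Hypothesis hp : uniformizer p.
Local Notation E := (calE R nu).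
Local Notation V := 'rV[E]_d.
Local Notation span_pi := (span_over (@S_nu_pi R nu)).
Local Notation span_u := (span_over (@S_nu_u R nu)).
Local Notation span_E := (span_over (@setT E)).
Implicit Types (M N A B : set V).

Lemma glue A B : is_submodule S_nu_pi A -> is_submodule S_nu_u B ->
  A `<=` cube S_nu_pi -> B `<=` cube S_nu_u -> span_E A = span_E B ->
  maximal_modules p (A `&` B) /\ Psi (A `&` B) = (A, B).
Proof.
move=> AP BP AS BS AB; split; first exact: cap_maximal.
by rewrite /Psi (span_pi_cap hp AP BP AB) (span_u_cap hp AP BP AB).
Qed.

Lemma span_pi_cube M : M `<=` cube S_nu -> span_pi M `<=` cube S_nu_pi.
Proof. exact: span_cube (S_nu_pi_subring R nu) (@S_nu_sub_pi R nu). Qed.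

Lemma span_u_cube M : M `<=` cube S_nu -> span_u M `<=` cube S_nu_u.
Proof. exact: span_cube (S_nu_u_subring R nu) (@S_nu_sub_u R nu). Qed.

Lemma span_E_piE M : span_E (span_pi M) = span_E M.
Proof. exact: span_span. Qed.

Lemma span_E_uE M : span_E (span_u M) = span_E M.
Proof. exact: span_span. Qed.

Lemma Psi_Free M : M `<=` cube S_nu ->
  Free S_nu_pi (Psi M).1 /\ Free S_nu_u (Psi M).2.
Proof.
move=> MS; split; apply: submod_Free.
- exact: S_nu_pi_subring.
- exact: principal_S_nu_pi.
- exact: span_submod.
- exact: span_pi_cube.
- exact: S_nu_u_subring.
- exact: principal_S_nu_u.
- exact: span_submod.
- exact: span_u_cube.
Qed.

Lemma maximal_capE M : maximal_modules p M -> M = span_pi M `&` span_u M.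
Proof. by case=> MP MS MM; rewrite -{1}MM; exact: MaxE. Qed.

(** Regrouping the four modules makes [M & M'] the gluing of the two componentwise intersections.
    These have the same E-span by [span_E_cap], applied once over each ring. *)
Lemma glue_cap M M' : maximal_modules p M -> maximal_modules p M' ->
  maximal_modules p (M `&` M') /\ Psi (M `&` M') =
    ((Psi M).1 `&` (Psi M').1, (Psi M).2 `&` (Psi M').2).
Proof.
move=> MM MM'; case: (MM) (MM') => MP MS _ [MP' MS' _].
have -> : M `&` M' = (span_pi M `&` span_pi M') `&` (span_u M `&` span_u M').
  by rewrite setIACA -!maximal_capE.
apply: glue.
- by apply: submodI; exact: span_submod.
- by apply: submodI; exact: span_submod.
- by move=> x [Mx _]; exact: span_pi_cube Mx.
- by move=> x [Mx _]; exact: span_u_cube Mx.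
rewrite (span_E_cap (S_nu_pi_subring R nu)); [|exact: span_submod..
  |exact: span_pi_cube|exact: span_pi_cube].
rewrite (span_E_cap (S_nu_u_subring R nu)); [|exact: span_submod..
  |exact: span_u_cube|exact: span_u_cube].
by rewrite !span_E_piE !span_E_uE.
Qed.

(** By [MaxE], the maximal sum is the gluing of the two modules generated by [addmod M M'], whose
    E-spans agree automatically. *)
Lemma glue_addmax M M' : maximal_modules p M -> maximal_modules p M' ->
  maximal_modules p (addmax p M M') /\ Psi (addmax p M M') =
    (addmod (Psi M).1 (Psi M').1, addmod (Psi M).2 (Psi M').2).
Proof.
move=> [MP MS _] [MP' MS' _].
have NP := submod_addmod MP MP'.
have NS : addmod M M' `<=` cube S_nu.
  have [_ SD _] : is_submodule S_nu (cube S_nu : set V).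
    exact/submod_cube/S_nu_subring.
  by move=> _ [x Mx [y My <-]]; apply: SD; [exact: MS|exact: MS'].
have [M0 _ _] := MP; have [M0' _ _] := MP'.
rewrite /Psi /= -!span_addmod // /addmax (MaxE hp NP NS).
apply: glue.
- exact: span_submod.
- exact: span_submod.
- exact: span_pi_cube.
- exact: span_u_cube.
- by rewrite span_E_piE span_E_uE.
Qed.

End Gluing.

Theorem theorem3p12 (R : completeDVRType) (p : R) (nu : rat) (d : nat)
    (hp : uniformizer p) (hd : (0 < d)%N) :
  let E := calE R nu in
  let MaxMod : set (set 'rV[E]_d) := maximal_modules p in
  let FreePi : set (set 'rV[E]_d) := Free S_nu_pi in
  let FreeU : set (set 'rV[E]_d) := Free S_nu_u in
  let same_span (A B : set 'rV[E]_d) :=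
    span_over setT A = span_over setT B in
  [/\ set_fun MaxMod (FreePi `*` FreeU) (@Psi R nu d),
      set_inj MaxMod (@Psi R nu d),
      @Psi R nu d @` MaxMod =
        [set AB | [/\ FreePi AB.1, FreeU AB.2 & same_span AB.1 AB.2]],
      forall A B, FreePi A -> FreeU B -> same_span A B ->
        MaxMod (A `&` B) /\ Psi (A `&` B) = (A, B)
    & forall M M', MaxMod M -> MaxMod M' ->
        [/\ MaxMod (M `&` M'),
            Psi (M `&` M') =
              ((Psi M).1 `&` (Psi M').1, (Psi M).2 `&` (Psi M').2),
            MaxMod (addmax p M M')
          & Psi (addmax p M M') =
              (addmod (Psi M).1 (Psi M').1, addmod (Psi M).2 (Psi M').2)]].
Proof.
move=> E MaxMod FreePi FreeU same_span.
have Psi_glue A B : FreePi A -> FreeU B -> same_span A B ->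
    MaxMod (A `&` B) /\ Psi (A `&` B) = (A, B).
  by move=> [AP AS _] [BP BS _] AB; exact: glue.
split=> //.
- by move=> M [_ MS _]; exact: Psi_Free.
- move=> M M' /set_mem MM /set_mem MM' [Epi Eu].
  by rewrite (maximal_capE hp MM) Epi Eu -(maximal_capE hp MM').
- rewrite eqEsubset; split=> [_ [M [_ MS _] <-]|[A B] /= [FA FB AB]].
    have [FA FB] := Psi_Free MS; split=> //.
    by rewrite /same_span span_E_piE span_E_uE.
  by have [MAB PAB] := Psi_glue A B FA FB AB; exists (A `&` B).
- move=> M M' MM MM'; have [? ?] := glue_cap hp MM MM'.
  by have [? ?] := glue_addmax hp MM MM'; split.
Qed.
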